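(* Let $\rho$ be the standard Gaussian density on $\mathbb{R}^m$, and let $f:\mathbb{R}^m\to\mathbb{R}$ be continuous and differentiable with continuous partial derivatives, with $f$ and each $\partial f/\partial x_i$ square-integrable with respect to $\rho$. Assume (i) $f$ is Lipschitz continuous with constant $L$, and (ii) $\lambda_n>\lambda_{n+1}$ for some $n<m$, where $\lambda_1\ge\cdots\ge\lambda_m\ge0$ are the eigenvalues of $C=\int\nabla f(x)\nabla f(x)^T\rho(x)\,dx=W\Lambda W^T$. Write $W=[W_1\ W_2]$ with $W_1\in\mathbb{R}^{m\times n}$ containing eigenvectors for $\lambda_1,\dots,\lambda_n$ and $W_2\in\mathbb{R}^{m\times(m-n)}$ containing eigenvectors for $\lambda_{n+1},\dots,\lambda_m$. Then $$\|\bar\nabla R(W_2)\|_F\;\le\; L\left(2m^{1/2}+(m-n)^{1/2}\right)\left(\lambda_{n+1}+\cdots+\lambda_m\right)^{1/2}.$$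
   Context: For $V\in\mathbb{R}^{m\times(m-n)}$ with orthonormal columns, define $$\mu(x,V)=\int_{\mathbb{R}^{m-n}} f\big((I-VV^T)x+Vz\big)\,\pi(z)\,dz,$$ where $\pi$ is the standard Gaussian density on $\mathbb{R}^{m-n}$ (this is the conditional density of the complement coordinates $z$ given the coordinates $y=U^Tx$ on the orthogonal complement $U$ of $\mathrm{span}(V)$, when $\rho$ is standard Gaussian; $\mu(\cdot,V)$ is the conditional average of $f$ over the affine subspace $\{(I-VV^T)x+Vz: z\in\mathbb{R}^{m-n}\}$). Define $R(V)=\tfrac12\int (f(x)-\mu(x,V))^2\rho(x)\,dx$, which depends only on $\mathrm{span}(V)$ and is thus a function on the Grassmann manifold $\mathbb{G}(m-n,m)$ of $(m-n)$-dimensional subspaces of $\mathbb{R}^m$. The Grassmann gradient is $\bar\nabla R(V)=(I-VV^T)\,\frac{\partial R}{\partial V}(V)$, where $\frac{\partial R}{\partial V}$ is the $m\times(m-n)$ matrix of partial derivatives of $R$ with respect to the entries $v_{ij}$ of $V$. $\|\cdot\|_F$ is the Frobenius norm. The span of $W_1$ is called the active subspace. *)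

(* Defs.v *)
From HB Require Import structures.
From mathcomp Require Import all_boot all_order all_algebra.
From mathcomp Require Import all_classical all_reals all_analysis.
Set Implicit Arguments. Unset Strict Implicit. Unset Printing Implicit Defensive.
Import Order.TTheory GRing.Theory Num.Theory.
Import numFieldNormedType.Exports.
Local Open Scope classical_set_scope.
Local Open Scope ring_scope.

Section Defs.
Variable R : realType.

Definition rho1 (t : R) : R := expR (- (t ^+ 2) / 2) / Num.sqrt (2 * pi).

(* Integral of F : R^m -> \bar R against the standard Gaussian density
   rho(x) = prod_i rho1(x_i) on R^m (points are column vectors),
   written as an iterated Lebesgue integral over the coordinates. *)
Fixpoint gint (m : nat) : ('cV[R]_m -> \bar R) -> \bar R :=
  match m return ('cV[R]_m -> \bar R) -> \bar R with
  | 0 => fun F => F 0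
  | m'.+1 => fun F =>
      (\int[lebesgue_measure]_t
         ((rho1 t)%:E * gint (fun y : 'cV[R]_m' => F (col_mx (t%:M) y))))%E
  end.

Definition greal (m : nat) (F : 'cV[R]_m -> R) : R := fine (gint (fun x => (F x)%:E)).

Definition enorm (m : nat) (x : 'cV[R]_m) : R := Num.sqrt (\sum_i x i 0 ^+ 2).

Definition frob (p q : nat) (A : 'M[R]_(p, q)) : R :=
  Num.sqrt (\sum_i \sum_j A i j ^+ 2).

Definition partial (m : nat) (f : 'cV[R]_m -> R) (i : 'I_m) (x : 'cV[R]_m) : R :=
  'D_(delta_mx i 0) f x.

Definition Cmat (m : nat) (f : 'cV[R]_m -> R) : 'M[R]_m :=
  \matrix_(i, j) greal (fun x => partial f i x * partial f j x).

Definition mu (m k : nat) (f : 'cV[R]_m -> R) (x : 'cV[R]_m) (V : 'M[R]_(m, k)) : R :=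
  greal (fun z : 'cV[R]_k => f ((1%:M - V *m V^T) *m x + V *m z)).

Definition Rres (m k : nat) (f : 'cV[R]_m -> R) (V : 'M[R]_(m, k)) : R :=
  2^-1 * greal (fun x => (f x - mu f x V) ^+ 2).

Definition dRdV (m k : nat) (f : 'cV[R]_m -> R) (V : 'M[R]_(m, k)) : 'M[R]_(m, k) :=
  \matrix_(i, j) 'D_(delta_mx i j) (Rres f) V.

Definition grassgrad (m k : nat) (f : 'cV[R]_m -> R) (V : 'M[R]_(m, k)) : 'M[R]_(m, k) :=
  (1%:M - V *m V^T) *m dRdV f V.

End Defs.

(* Main.v *)
(** Put V = W_2, P = 1 - V V^T, r = f - mu(., V) and p = P x + V z for
    independent standard Gaussian x in R^m and z in R^k.

    Differentiating under the integral, the derivative of R at V in a direction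
    E is - E[r(x) <grad f(p), q_E>], where q_E = - (E V^T + V E^T) x + E z.
    With B = P dR/dV one has V^T B = 0 and |B|^2 = <B, dR/dV>, and the second
    moment of q_B is 3 |B|^2; as |<grad f, q_B>| <= L |q_B|, this gives
    |B|^2 <= 3 L^2 E[r^2].

    By Jensen E[r^2] <= E[(f(x) - f(p))^2], and p is the image of x when the
    pair (V^T x, z) is rotated by the angle pi/2.  Cutting the rotation into N
    equal steps and using the rotation invariance of the Gaussian measure,
    E[(f(x) - f(p))^2] is at most N^2 times the mean square increment over the
    first step; letting N tend to infinity bounds it by
    (pi/2)^2 E|V^T grad f|^2 <= 4 (lambda_{n+1} + ... + lambda_m).
    Hence |B|^2 <= 12 L^2 (lambda_{n+1} + ... + lambda_m), and
    12 <= (2 sqrt m + sqrt k)^2 because m >= 2 and k >= 1.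

    Rotation invariance is proved by Gaussian elimination: the Lebesgue
    integral scales by the determinant under shears and diagonal maps. *)

Require Import Defs.
From HB Require Import structures.
From mathcomp Require Import all_boot all_order all_algebra.
From mathcomp Require Import all_classical all_reals all_analysis.
From mathcomp Require Import measurable_realfun.
From mathcomp Require Import ring lra.
Import Order.TTheory GRing.Theory Num.Theory.
Import numFieldNormedType.Exports.
Local Open Scope classical_set_scope.
Local Open Scope ring_scope.
Set Implicit Arguments. Unset Strict Implicit. Unset Printing Implicit Defensive.

(** * Gaussian measure on column vectors *)

Section measurable_column.
Context {R : realType}.
Variable m : nat.

Let coor (i : 'I_m) (x : 'cV[R]_m) : R := x i 0.

Let column_set0 : g_sigma_preimage coor set0.
Proof. exact: sigma_algebra0. Qed.

Let column_setC A : g_sigma_preimage coor A -> g_sigma_preimage coor (~` A).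
Proof. exact: sigma_algebraC. Qed.

Let column_bigcup (F : _^nat) : (forall i, g_sigma_preimage coor (F i)) ->
  g_sigma_preimage coor (\bigcup_i (F i)).
Proof. exact: sigma_algebra_bigcup. Qed.

(** Columns carry the sigma-algebra generated by their coordinates. Measurability of a column-valued
    map can then be tested one coordinate at a time; for continuous functions it takes the separate
    argument of [continuous_measurable_column]. *)
HB.instance Definition _ := @isMeasurable.Build default_measure_display
  'cV[R]_m (g_sigma_preimage coor) column_set0 column_setC column_bigcup.

Lemma measurable_coor (i : 'I_m) :
  measurable_fun [set: 'cV[R]_m] (fun x => x i 0 : R).
Proof.
move=> _ Y mY; rewrite setTI; apply: sub_sigma_algebra => /=.
rewrite -bigcup_seq/=; exists i => /=; first by rewrite mem_index_enum.
by exists Y => //; rewrite setTI.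
Qed.

Lemma measurable_fun_coorP d (T : measurableType d) (f : T -> 'cV[R]_m) :
  (forall i, measurable_fun [set: T] (fun t => f t i 0 : R)) ->
  measurable_fun [set: T] f.
Proof.
move=> mf.
suff sub : g_sigma_preimage (fun i => coor i \o f) `<=` measurable.
  move: sub; rewrite g_sigma_preimage_comp => sub _ A mA.
  by apply: sub; exists A.
apply: smallest_sub; first exact: sigma_algebra_measurable.
rewrite -bigcup_seq; apply: bigcup_sub => i _ A [B mB <-].
exact: mf.
Qed.

(** An open set is the union of the boxes with rational centre and radius [1/(n+1)] that it
    contains. There are countably many of them, and each is a finite intersection of coordinate
    preimages. *)
Lemma continuous_measurable_column (f : 'cV[R]_m -> R) :
  continuous f -> measurable_fun setT f.
Proof.
move=> /continuousP cf; apply: (measurability _ (RGenOpens.measurableE R)).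
move=> _ [_ [a [b ->]] <-]; rewrite setTI.
set O := f @^-1` _.
have oO : open O by apply: cf; exact: interval_open.
pose B (q : 'cV[rat]_m * nat) := [set x : 'cV[R]_m |
  forall i, `|ratr (q.1 i 0) - x i 0| < q.2.+1%:R^-1].
have mB q : measurable (B q).
  have -> : B q = \bigcap_(i in setT)
      (fun x : 'cV[R]_m => x i 0) @^-1` (ball (ratr (q.1 i 0) : R) q.2.+1%:R^-1).
    by apply/seteqP; split=> x /= xB i; [move=> _|]; apply: xB.
  apply: fin_bigcap_measurable => // i _; rewrite -[_ @^-1` _]setTI.
  by apply: measurable_coor => //; exact: measurable_ball.
have -> : O = \bigcup_(q in [set q | B q `<=` O]) B q.
  apply/seteqP; split=> [x Ox|x [q /= BO Bx]]; last exact: BO.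
  have /nbhs_ballP[e /= e0 xeO] : nbhs x O by exact: open_nbhs_nbhs.
  (* The radius is below [e/2], so a box whose centre is within one radius of [x] lies in the
     [e]-ball around [x]. *)
  pose n := Num.truncn (2 / e).
  have ne : n.+1%:R^-1 < e / 2.
    by rewrite -[ltRHS]invrK ltf_pV2 ?posrE ?invr_gt0 ?divr_gt0// invf_div
      truncnS_gt.
  have /choice[q qP] (i : 'I_m) : exists q : rat, `|ratr q - x i 0| < n.+1%:R^-1.
    have [|q] := @rat_in_itvoo R (x i 0 - n.+1%:R^-1) (x i 0 + n.+1%:R^-1).
      by rewrite ltrD2l gtrN// invr_gt0.
    by rewrite in_itv/= => qi; exists q; rewrite ltr_distl.
  exists (\col_i q i, n); last by move=> i /=; rewrite mxE.
  move=> y /= By; apply: xeO; split=> // i j; rewrite (ord1 j) /ball/=.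
  rewrite (splitr e); have := By i; rewrite /= mxE => yq.
  rewrite (le_lt_trans (ler_distD (ratr (q i)) _ _))// ltrD//.
    by rewrite distrC (lt_trans (qP i)).
  exact: lt_trans ne.
rewrite bigcup_mkcond; apply: countable_bigcupT_measurable => // q.
by case: ifP.
Qed.

End measurable_column.

(** * The standard Gaussian probability on R^m *)

Section gaussian_measure.
Context {R : realType}.
Local Notation leb := (@lebesgue_measure R).

Lemma rho1E (t : R) : rho1 t = normal_pdf 0 1 t.
Proof.
rewrite normal_pdfE ?oner_neq0// /rho1 /normal_peak /normal_fun.
by rewrite subr0 expr1n mul1r mulrC -(mulr_natl pi).
Qed.

Lemma rho1_gt0 (t : R) : 0 < rho1 t.
Proof. by rewrite divr_gt0 ?expR_gt0// sqrtr_gt0 mulr_gt0// pi_gt0. Qed.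

Lemma measurable_rho1 : measurable_fun [set: measurableTypeR R] (@rho1 R).
Proof.
rewrite (_ : @rho1 R = normal_pdf 0 1); first exact: measurable_normal_pdf.
by apply/funext => t; rewrite rho1E.
Qed.

Import HBNNSimple.

(** On indicators this is the definition of [normal_prob]. Linearity extends it to simple functions,
    and monotone convergence on both sides extends it to [f]. *)
Lemma ge0_integral_normal_prob (f : measurableTypeR R -> \bar R) :
  measurable_fun setT f -> (forall t, 0 <= f t)%E ->
  (\int[normal_prob 0 1]_t f t = \int[leb]_t ((rho1 t)%:E * f t))%E.
Proof.
move=> mf f0.
have mr : measurable_fun [set: measurableTypeR R] (EFin \o @rho1 R).
  by apply/measurable_EFinP; exact: measurable_rho1.
have r0 t : (0 <= (rho1 t)%:E :> \bar R)%E by rewrite lee_fin ltW// rho1_gt0.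
have mI (A : set (measurableTypeR R)) : measurable A ->
    measurable_fun [set: measurableTypeR R] (fun t => (\1_A t)%:E : \bar R).
  by move=> mA; apply/measurable_EFinP; exact: measurable_indic.
pose g := nnsfun_approx measurableT mf.
have gf t : (EFin \o g ^~ t) @ \oo --> f t by apply: cvg_nnsfun_approx.
have ndg t : {homo (fun n => (g n t)%:E) : a b / (a <= b)%N >-> (a <= b)%E}.
  by move=> a b ab; rewrite lee_fin; exact/lefP/nd_nnsfun_approx.
transitivity (limn (fun n => \int[normal_prob 0 1]_t (g n t)%:E))%E.
  rewrite -monotone_convergence; last 4 first.
  - exact: measurableT.
  - by move=> n; apply/measurable_EFinP.
  - by move=> n t _; rewrite lee_fin.
  - by move=> t _ a b; exact: ndg.
  by apply: eq_integral => t _; apply/esym/cvg_lim => //; exact: gf.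
transitivity (limn (fun n => \int[leb]_t ((rho1 t)%:E * (g n t)%:E)))%E; last first.
  rewrite -monotone_convergence; last 4 first.
  - exact: measurableT.
  - by move=> n; apply: emeasurable_funM => //; apply/measurable_EFinP.
  - by move=> n t _; rewrite mule_ge0// lee_fin.
  - by move=> t _ a b ab; rewrite lee_pmul//; [rewrite lee_fin|exact: ndg].
  apply: eq_integral => t _; apply/cvg_lim => //.
  by apply: cvgeMl => //; exact: gf.
congr (limn _); apply/funext => n.
under eq_integral do rewrite fimfunE -fsumEFin//.
rewrite ge0_integral_fsum//=; last 2 first.
- by move=> r; exact/measurable_EFinP/measurableT_comp.
- by move=> r t _; rewrite nnfun_muleindic_ge0.
under [RHS]eq_integral.
  move=> t _; rewrite fimfunE -fsumEFin// ge0_mule_fsumr; last first.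
    by move=> r; rewrite nnfun_muleindic_ge0.
  over.
rewrite ge0_integral_fsum//=; last 2 first.
- by move=> r; apply: emeasurable_funM => //; exact/measurable_EFinP/measurableT_comp.
- by move=> r t _; rewrite mule_ge0// nnfun_muleindic_ge0.
apply: eq_fsbigr => r /[!inE] -[t0 _ <-].
under eq_integral do rewrite EFinM.
have mg : measurable (g n @^-1` [set g n t0] : set (measurableTypeR R)).
  exact: measurable_funPTI.
rewrite ge0_integralZl//; last 2 first.
- exact: mI.
- by rewrite lee_fin.
under [RHS]eq_integral do rewrite (EFinM (g n t0)) muleCA.
rewrite ge0_integralZl//; last 3 first.
- by apply: emeasurable_funM => //; exact: mI.
- by move=> t _; rewrite mule_ge0// lee_fin.
- by rewrite lee_fin.
congr (_ * _)%E; rewrite integral_indic// setIT /normal_prob.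
rewrite [LHS]integral_mkcond; apply: eq_integral => t _.
by rewrite patchE indicE -rho1E; case: ifP; rewrite ?mule1 ?mule0.
Qed.

Lemma measurable_col_mx p q d (T : measurableType d) (f : T -> 'cV[R]_p)
    (g : T -> 'cV[R]_q) : measurable_fun setT f -> measurable_fun setT g ->
  measurable_fun setT (fun t => col_mx (f t) (g t)).
Proof.
move=> mf mg; apply: measurable_fun_coorP => i.
case: (split_ordP i) => j ->.
  under eq_fun do rewrite col_mxEu.
  exact: (measurableT_comp (measurable_coor j)).
under eq_fun do rewrite col_mxEd.
exact: (measurableT_comp (measurable_coor j)).
Qed.

Lemma measurable_slice p q d (U : measurableType d) (F : 'cV[R]_(p + q) -> U)
    (x : 'cV[R]_p) : measurable_fun setT F ->
  measurable_fun setT (fun y => F (col_mx x y)).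
Proof.
move=> mF; apply: (measurableT_comp (f := F)) => //.
by apply: measurable_col_mx => //; exact: measurable_id.
Qed.

Lemma measurable_scalar_column d (T : measurableType d) (f : T -> R) :
  measurable_fun setT f -> measurable_fun setT (fun t => (f t)%:M : 'cV[R]_1).
Proof.
move=> mf; apply: measurable_fun_coorP => i.
by under eq_fun do rewrite mxE ord1 eqxx mulr1n.
Qed.

Definition cons_column m (z : measurableTypeR R * 'cV[R]_m) : 'cV[R]_(1 + m) :=
  col_mx (z.1%:M) z.2.

Lemma measurable_cons_column m : measurable_fun setT (@cons_column m).
Proof.
apply: measurable_col_mx; last exact: measurable_snd.
exact: measurable_scalar_column.
Qed.

HB.instance Definition _ m :=
  isMeasurableFun.Build _ _ _ _ (@cons_column m) (@measurable_cons_column m).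

(** The recursion peels off one coordinate, as [gint] does, so that the two can be compared by
    induction on the dimension. In dimension 0 the only probability is the point mass at the empty
    column. *)
Fixpoint gaussian (m : nat) : probability 'cV[R]_m R :=
  match m with
  | 0 => [the probability _ _ of @dirac _ 'cV[R]_0 (0 : 'cV[R]_0) R]
  | m'.+1 => distribution (normal_prob 0 1 \x gaussian m')%E (@cons_column m')
  end.

Lemma ge0_integral_gaussianS m (F : 'cV[R]_(1 + m) -> \bar R) :
  measurable_fun setT F -> (forall x, 0 <= F x)%E ->
  (\int[gaussian m.+1]_x F x =
   \int[leb]_t ((rho1 t)%:E * \int[gaussian m]_y F (col_mx t%:M y)))%E.
Proof.
move=> mF F0.
have mF' := measurableT_comp mF (@measurable_cons_column m).
rewrite [LHS](@ge0_integral_distribution _ _ _ _ _ _ (@cons_column m))//.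
rewrite fubini_tonelli1//; last by move=> z; exact: F0.
rewrite ge0_integral_normal_prob//.
- by apply: measurable_fun_fubini_tonelli_F => // z; exact: F0.
- by move=> t; apply: integral_ge0 => y _; exact: F0.
Qed.

End gaussian_measure.

(** * Functions of quadratic growth *)

Section quadratic_growth.
Context {R : realType}.
Local Notation leb := (@lebesgue_measure R).

Definition sq m (x : 'cV[R]_m) : R := \sum_i x i 0 ^+ 2.

Lemma sq_ge0 m (x : 'cV[R]_m) : 0 <= sq x.
Proof. by apply: sumr_ge0 => i _; exact: sqr_ge0. Qed.

Lemma sq_col_mx p q (x : 'cV[R]_p) (y : 'cV[R]_q) :
  sq (col_mx x y) = sq x + sq y.
Proof.
rewrite /sq big_split_ord/=; congr (_ + _); apply: eq_bigr => i _.
  by rewrite col_mxEu.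
by rewrite col_mxEd.
Qed.

Lemma sqZ m a (x : 'cV[R]_m) : sq (a *: x) = a ^+ 2 * sq x.
Proof. by rewrite /sq mulr_sumr; apply: eq_bigr => i _; rewrite mxE exprMn. Qed.

Lemma sqD_le m (x y : 'cV[R]_m) : sq (x + y) <= 2 * (sq x + sq y).
Proof.
rewrite /sq -big_split mulr_sumr; apply: ler_sum => i _ /=; rewrite mxE.
by have := sqr_ge0 (x i 0 - y i 0); nra.
Qed.

Lemma sq_trmx m (x : 'cV[R]_m) : sq x = (x^T *m x) 0 0.
Proof. by rewrite mxE; apply: eq_bigr => i _; rewrite mxE expr2. Qed.

Lemma measurable_sq m : measurable_fun setT (@sq m).
Proof.
apply: measurable_sum => i; apply: measurable_funX; exact: measurable_coor.
Qed.

(* [exp u >= 1 + u] bounds t^2 by the ratio of the centred Gaussian density of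
   deviation s > 1 to rho1; then s tends to 1. *)
Lemma moment2_rho1 : (\int[leb]_t ((rho1 t)%:E * (t ^+ 2)%:E) <= 1)%E.
Proof.
pose A := (\int[leb]_t ((rho1 t)%:E * (t ^+ 2)%:E))%E.
have A0 : (0 <= A)%E.
  by apply: integral_ge0 => t _; rewrite mule_ge0// lee_fin ?sqr_ge0 ?ltW ?rho1_gt0.
have mA : measurable_fun [set: measurableTypeR R]
    (fun t => (rho1 t)%:E * (t ^+ 2)%:E)%E.
  apply: emeasurable_funM; apply/measurable_EFinP; first exact: measurable_rho1.
  exact: measurable_funX.
have key (s : R) : 1 < s -> (A <= (2 * s ^+ 2 / (s + 1))%:E)%E.
  (* [s] times the density of deviation [s], divided by [rho1], is [exp(h t^2/2)], which is at least
     [1 + h t^2/2]. Integrating gives [A + 2/h <= 2s/h], and [(2/h)(s - 1) = 2s^2/(s + 1)]. *)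
  move=> s1; pose h := 1 - s ^- 2.
  have s0 : s != 0 by rewrite gt_eqF// (lt_trans _ s1).
  have h0 : 0 < h by rewrite subr_gt0 invf_lt1 ?exprn_gt0 ?exprn_egt1// (lt_trans _ s1).
  have pdfE t : s * normal_pdf 0 s t = rho1 t * expR (h * t ^+ 2 / 2).
    rewrite normal_pdfE// /rho1 /normal_peak /normal_fun subr0.
    rewrite [RHS]mulrAC -expRD -(mulr_natl (_ * pi)) [2 * _]mulrCA.
    rewrite sqrtrM ?sqr_ge0// sqrtr_sqr ger0_norm; last first.
      by rewrite ltW// (lt_trans _ s1).
    rewrite invfM mulrA mulrA mulfV// mul1r mulrC; congr (expR _ / _).
    by rewrite /h -mulr_natr; field.
  have le t : rho1 t * t ^+ 2 + 2 / h * rho1 t <= 2 / h * (s * normal_pdf 0 s t).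
    rewrite pdfE; have := expR_ge1Dx (h * t ^+ 2 / 2).
    move=> /(ler_wpM2l (ltW (rho1_gt0 t))).
    move=> /(ler_wpM2l (ltW (divr_gt0 (ltr0n _ 2) h0))).
    apply: le_trans; rewrite le_eqVlt; apply/orP; left; apply/eqP.
    by field; rewrite gt_eqF.
  have : (A + (2 / h)%:E <= (2 / h * s)%:E)%E.
    have -> : ((2 / h)%:E = \int[leb]_t ((2 / h)%:E * (rho1 t)%:E))%E.
      rewrite ge0_integralZl//; last 3 first.
      - by apply/measurable_EFinP; exact: measurable_rho1.
      - by move=> t _; rewrite lee_fin ltW ?rho1_gt0.
      - by rewrite lee_fin ltW// divr_gt0.
      by under eq_integral do rewrite rho1E; rewrite integral_normal_pdf mule1.
    have -> : ((2 / h * s)%:E = \int[leb]_t ((2 / h * s)%:E * (normal_pdf 0 s t)%:E))%E.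
      rewrite ge0_integralZl//; last 3 first.
      - by apply/measurable_EFinP; exact: measurable_normal_pdf.
      - by move=> t _; rewrite lee_fin normal_pdf_ge0.
      - by rewrite lee_fin ltW// mulr_gt0 ?divr_gt0// (lt_trans _ s1).
      by rewrite integral_normal_pdf mule1.
    rewrite -ge0_integralD//; last 3 first.
    - by move=> t _; rewrite mule_ge0// lee_fin ?sqr_ge0 ?ltW ?rho1_gt0.
    - by move=> t _; rewrite mule_ge0// lee_fin ltW ?rho1_gt0// divr_gt0.
    - by apply: measurable_funeM; apply/measurable_EFinP; exact: measurable_rho1.
    apply: ge0_le_integral => //.
    - move=> t _; rewrite adde_ge0// mule_ge0// lee_fin ?sqr_ge0 ?ltW ?rho1_gt0//.
      by rewrite divr_gt0.
    - apply: emeasurable_funD => //; apply: measurable_funeM.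
      by apply/measurable_EFinP; exact: measurable_rho1.
    - apply: measurable_funeM; apply/measurable_EFinP; exact: measurable_normal_pdf.
    - by move=> t _; rewrite -!EFinM -EFinD lee_fin -(mulrA _ s).
  rewrite -leeBrDr// -EFinB; move=> /le_trans; apply; rewrite lee_fin.
  rewrite le_eqVlt; apply/orP; left; apply/eqP; rewrite /h; field.
  by rewrite s0 !gt_eqF//; nra.
have Afin : A \is a fin_num.
  by rewrite ge0_fin_numE//; apply: le_lt_trans (key 2 _) _; rewrite ?ltry// ltr1n.
have {}key (s : R) : 1 < s -> fine A * (s + 1) <= 2 * s ^+ 2.
  move=> s1; have := key _ s1; rewrite -{1}(fineK Afin) lee_fin ler_pdivlMr//.
  by rewrite addr_gt0// (lt_trans _ s1).
rewrite -/A -(fineK Afin) lee_fin leNgt; apply/negP => A1.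
have A2 := key 2 (ltr1n _ _).
(* If [A = 1 + 4d] with [d > 0], then [s = 1 + d] would give [5d + 2d^2 <= 0]. *)
have := key (1 + (fine A - 1) / 4).
rewrite ltrDl divr_gt0 ?subr_gt0// => /(_ isT).
by move: A1 A2; set a := fine A; nra.
Qed.

Lemma moment2_coor m (i : 'I_m) : (\int[@gaussian R m]_x (x i 0 ^+ 2)%:E <= 1)%E.
Proof.
elim: m i => [[]//|m IH]; rewrite -[m.+1]/(1 + m)%N => i.
pose F (x : 'cV[R]_(1 + m)) : \bar R := (x i 0 ^+ 2)%:E.
rewrite (ge0_integral_gaussianS (F := F)); last 2 first.
- by apply/measurable_EFinP; apply: measurable_funX; exact: measurable_coor.
- by move=> x; rewrite lee_fin sqr_ge0.
rewrite {}/F; case: (split_ordP i) => j ->.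
  rewrite (eq_integral (fun t : measurableTypeR R => (rho1 t)%:E * (t ^+ 2)%:E)%E).
    exact: moment2_rho1.
  move=> t _; rewrite (eq_integral (cst (t ^+ 2)%:E)); last first.
    by move=> y _; rewrite col_mxEu mxE ord1 eqxx mulr1n.
  rewrite integral_cst// (_ : (_ [set: _]) = 1%E) ?mule1//. exact: (probability_setT (gaussian m)).
rewrite (eq_integral (fun t : measurableTypeR R => (rho1 t)%:E * \int[gaussian m]_y (y j 0 ^+ 2)%:E)%E);
  last by move=> t _; congr (_ * _)%E; apply: eq_integral => y _; rewrite col_mxEd.
rewrite (_ : 1%E = \int[leb]_t ((rho1 t)%:E * 1))%E; last first.
  by under eq_integral do rewrite mule1 rho1E; rewrite integral_normal_pdf.
apply: ge0_le_integral => //.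
- move=> t _; apply: mule_ge0; first by rewrite lee_fin ltW// rho1_gt0.
  by apply: integral_ge0 => y _; rewrite lee_fin sqr_ge0.
- apply: emeasurable_funM; last exact: measurable_cst.
  by apply/measurable_EFinP; exact: measurable_rho1.
- apply: emeasurable_funM; last exact: measurable_cst.
  by apply/measurable_EFinP; exact: measurable_rho1.
- move=> t _; apply: lee_pmul; [|by apply: integral_ge0 => y _; rewrite lee_fin sqr_ge0| |exact: IH].
    by rewrite lee_fin ltW// rho1_gt0.
  by [].
Qed.

Lemma integral_gaussian1 m : (\int[@gaussian R m]_x 1 = 1)%E.
Proof.
rewrite (_ : (fun=> 1%E) = cst 1%E)// integral_cst// mul1e.
exact: (probability_setT (gaussian m)).
Qed.

(** The working class of integrands: it contains the squares of Lipschitz functions, is integrable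
    in every dimension, and is stable under sums, linear substitutions, slices and partial
    expectations. It is not stable under products, so each product needs its own bound. *)
Definition qgrowth m (F : 'cV[R]_m -> R) :=
  measurable_fun setT F /\ exists2 C, 0 <= C & forall x, `|F x| <= C * (1 + sq x).

(** The mean of [C (1 + sq x)] is at most [C (1 + m)] by [moment2_coor]. *)
Lemma integrable_qgrowth m (F : 'cV[R]_m -> R) :
  qgrowth F -> (gaussian m).-integrable setT (EFin \o F).
Proof.
move=> [mF [C C0 FC]]; apply/integrableP; split; first exact/measurable_EFinP.
apply: (@le_lt_trans _ _ (\int[gaussian m]_x (C%:E * (1 + \sum_(i < m) (x i 0 ^+ 2)%:E)))%E).
  apply: ge0_le_integral => //.
  - by apply: measurableT_comp => //; exact/measurable_EFinP.
  - apply: measurable_funeM; apply: emeasurable_funD => //.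
    apply: emeasurable_sum => i; apply/measurable_EFinP; apply: measurable_funX.
    exact: measurable_coor.
  - by move=> x _; rewrite sumEFin -EFinD -EFinM lee_fin FC.
have msq i : measurable_fun setT (fun x : 'cV[R]_m => (x i 0 ^+ 2)%:E).
  by apply/measurable_EFinP; apply: measurable_funX; exact: measurable_coor.
have sq0 i (x : 'cV[R]_m) : setT x -> (0 <= (x i 0 ^+ 2)%:E)%E.
  by move=> _; rewrite lee_fin sqr_ge0.
rewrite ge0_integralZl//; last 2 first.
- by apply: emeasurable_funD => //; exact: emeasurable_sum.
- by move=> x _; apply: adde_ge0 => //; apply: sume_ge0 => i _; exact: sq0.
rewrite ge0_integralD//; last 2 first.
- by move=> x _; apply: sume_ge0 => i _; exact: sq0.
- exact: emeasurable_sum.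
rewrite integral_gaussian1 ge0_integral_sum//.
apply: (@le_lt_trans _ _ (C%:E * (1 + \sum_(i < m) 1))%E); last first.
  by rewrite sumEFin -EFinD -EFinM ltry.
apply: lee_pmul; rewrite ?lee_fin//.
  by apply: adde_ge0 => //; apply: sume_ge0 => i _; apply: integral_ge0 => x; exact: sq0.
by apply: leeD => //; apply: lee_sum => i _; exact: moment2_coor.
Qed.

Lemma qgrowth_cst m (c : R) : qgrowth (fun _ : 'cV[R]_m => c).
Proof.
split; first exact: measurable_cst.
by exists `|c| => // x; rewrite ler_peMr// lerDl sq_ge0.
Qed.

Lemma qgrowthD m (F G : 'cV[R]_m -> R) :
  qgrowth F -> qgrowth G -> qgrowth (fun x => F x + G x).
Proof.
move=> [mF [C C0 FC]] [mG [D D0 GD]]; split; first exact: measurable_funD.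
exists (C + D); first exact: addr_ge0.
by move=> x; rewrite mulrDl (le_trans (ler_normD _ _))// lerD.
Qed.

Lemma qgrowthZ m a (F : 'cV[R]_m -> R) : qgrowth F -> qgrowth (fun x => a * F x).
Proof.
move=> [mF [C C0 FC]]; split; first exact: measurable_funM.
exists (`|a| * C); first by rewrite mulr_ge0.
by move=> x; rewrite normrM -mulrA ler_wpM2l.
Qed.

Lemma qgrowthB m (F G : 'cV[R]_m -> R) :
  qgrowth F -> qgrowth G -> qgrowth (fun x => F x - G x).
Proof.
move=> qF /(@qgrowthZ _ (-1)) qG.
by under eq_fun do rewrite -[- G _]mulN1r; exact: qgrowthD.
Qed.

Lemma qgrowth_sum m I (r : seq I) (F : I -> 'cV[R]_m -> R) :
  (forall i, qgrowth (F i)) -> qgrowth (fun x => \sum_(i <- r) F i x).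
Proof.
move=> qF; elim: r => [|i r IH].
  by under eq_fun do rewrite big_nil; exact: qgrowth_cst.
by under eq_fun do rewrite big_cons; exact: qgrowthD.
Qed.

Lemma qgrowth_sq m : qgrowth (@sq m).
Proof.
split; first exact: measurable_sq.
by exists 1 => // x; rewrite mul1r ger0_norm ?sq_ge0// lerDr.
Qed.

Lemma qgrowth_le m (F G : 'cV[R]_m -> R) : measurable_fun setT F ->
  qgrowth G -> (forall x, `|F x| <= G x) -> qgrowth F.
Proof.
move=> mF [_ [C C0 GC]] FG; split=> //; exists C => // x.
by rewrite (le_trans (FG x))// (le_trans (ler_norm _)).
Qed.

Lemma qgrowth_slice p q (F : 'cV[R]_(p + q) -> R) x :
  qgrowth F -> qgrowth (fun y => F (col_mx x y)).
Proof.
move=> [mF [C C0 FC]]; split; first exact: measurable_slice.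
exists (C * (1 + sq x)); first by rewrite mulr_ge0// addr_ge0// sq_ge0.
move=> y; rewrite (le_trans (FC _))// -mulrA ler_wpM2l// sq_col_mx.
by have := sq_ge0 x; have := sq_ge0 y; nra.
Qed.

End quadratic_growth.

(** * Products of Gaussian measures *)

Section gaussian_product.
Context {R : realType}.
Local Notation leb := (@lebesgue_measure R).

(** The dimensions [1 + (p + q)] and [(1 + p) + q] are convertible, so the equation is well typed
    without a cast. *)
Lemma col_mx_consA p q (t : 'cV[R]_1) (x : 'cV[R]_p) (y : 'cV[R]_q) :
  col_mx t (col_mx x y) = col_mx (col_mx t x) y :> 'cV[R]_(1 + (p + q)).
Proof.
apply/colP => i; case: (split_ordP i) => j ->{i}.
  rewrite col_mxEu -(col_mxEu t x j) -(col_mxEu (col_mx t x) y).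
  by congr (col_mx (col_mx t x) y _ _); exact: val_inj.
rewrite col_mxEd; case: (split_ordP j) => l ->{j}.
  rewrite col_mxEu -(col_mxEd t x l) -(col_mxEu (col_mx t x) y).
  by congr (col_mx (col_mx t x) y _ _); exact: val_inj.
rewrite col_mxEd -(col_mxEd (col_mx t x) y).
by congr (col_mx (col_mx t x) y _ _); apply: val_inj; rewrite /= addnA.
Qed.

Definition cat_column p q (z : 'cV[R]_p * 'cV[R]_q) := col_mx z.1 z.2.

Lemma measurable_cat_column p q : measurable_fun setT (@cat_column p q).
Proof. by apply: measurable_col_mx. Qed.

Lemma ge0_measurable_integral_slice p q (F : 'cV[R]_(p + q) -> \bar R) :
  measurable_fun setT F -> (forall x, 0 <= F x)%E ->
  measurable_fun setT (fun x => \int[gaussian q]_y F (col_mx x y))%E.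
Proof.
move=> mF F0.
apply: (@measurable_fun_fubini_tonelli_F _ _ _ _ _ (gaussian q)
  (fun z => F (col_mx z.1 z.2))); last by move=> z; exact: F0.
exact: (measurableT_comp mF (@measurable_cat_column p q)).
Qed.

(** Induction on [p]: the first coordinate is peeled off both sides, and the base case integrates
    against a point mass. *)
Lemma ge0_integral_split p q (F : 'cV[R]_(p + q) -> \bar R) :
  measurable_fun setT F -> (forall x, 0 <= F x)%E ->
  (\int[gaussian (p + q)]_x F x = \int[gaussian p]_x \int[gaussian q]_y F (col_mx x y))%E.
Proof.
elim: p F => [|p IH] F mF F0.
  rewrite [RHS]integral_dirac//; last exact: ge0_measurable_integral_slice.
  rewrite diracT mul1e; apply: eq_integral => y _; congr F.
  apply/colP => i; rewrite mxE; case: splitP => [[]//|j ij].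
  by congr (y _ _); apply: val_inj.
have mG := ge0_measurable_integral_slice mF F0.
rewrite [LHS](@ge0_integral_gaussianS _ (p + q) F)// [RHS](@ge0_integral_gaussianS _ p)//; last first.
  by move=> x; apply: integral_ge0 => y _; exact: F0.
apply: eq_integral => t _; congr (_ * _)%E.
rewrite (IH (fun v => F (@col_mx _ 1 (p + q) 1 t%:M v)))//; last exact: (@measurable_slice _ 1).
apply: eq_integral => x _; apply: eq_integral => y _.
by rewrite col_mx_consA.
Qed.

HB.instance Definition _ p q := isMeasurableFun.Build _ _ _ _
  (@cat_column p q) (@measurable_cat_column p q).

(** An equality of measures, obtained by testing [ge0_integral_split] on indicators, gives access to
    Fubini for signed functions in [Rintegral_split]. *)
Lemma gaussian_split p q (A : set 'cV[R]_(p + q)) : measurable A ->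
  gaussian (p + q) A =
  pushforward (gaussian p \x gaussian q)%E (@cat_column p q) A.
Proof.
move=> mA.
have mI : measurable_fun setT (fun x : 'cV[R]_(p + q) => (\1_A x)%:E : \bar R).
  by apply/measurable_EFinP; exact: measurable_indic.
have mB : measurable (@cat_column p q @^-1` A).
  by rewrite -[X in measurable X]setTI; exact: measurable_cat_column.
transitivity (\int[gaussian (p + q)]_x (\1_A x)%:E)%E.
  by rewrite integral_indic// setIT.
rewrite ge0_integral_split//.
transitivity (\int[gaussian p \x gaussian q]_z (\1_(@cat_column p q @^-1` A) z)%:E)%E; last first.
  by rewrite integral_indic// setIT.
by rewrite fubini_tonelli1//; apply/measurable_EFinP/measurable_indic.
Qed.

Lemma integrable_split p q (F : 'cV[R]_(p + q) -> R) : qgrowth F ->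
  (gaussian p \x gaussian q)%E.-integrable setT
    (fun z : 'cV[R]_p * 'cV[R]_q => (F (col_mx z.1 z.2))%:E).
Proof.
move=> qF; have := integrable_qgrowth qF => /integrableP[mF iF].
have mF' := measurableT_comp mF (@measurable_cat_column p q).
apply/integrable12ltyP => //=.
rewrite -(@ge0_integral_split _ _ (fun x => `|(F x)%:E|%E))//.
exact: measurableT_comp.
Qed.

Lemma EFin_Rintegral m (F : 'cV[R]_m -> R) : qgrowth F ->
  (\int[gaussian m]_x F x)%:E = (\int[gaussian m]_x (F x)%:E)%E.
Proof.
by move=> qF; rewrite fineK//; apply: integrable_fin_num => //; exact: integrable_qgrowth.
Qed.

(** Measurability is part of Fubini. The growth bound integrates [C (1 + sq x)(1 + sq y)] over
    [y]. *)
Lemma qgrowth_expectation p q (F : 'cV[R]_(p + q) -> R) : qgrowth F ->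
  qgrowth (fun x => \int[gaussian q]_y F (col_mx x y)).
Proof.
move=> qF; split.
  have -> : (fun x => \int[gaussian q]_y F (col_mx x y)) =
      fine \o (fun x => \int[gaussian q]_y (F (col_mx x y))%:E)%E by [].
  apply: measurableT_comp => //.
  exact: (measurable_fubini_F (integrable_split qF)).
have [_ [C C0 FC]] := qF.
pose K := Rintegral (gaussian q) setT (fun y : 'cV[R]_q => 1 + sq y).
have qK : qgrowth (fun y : 'cV[R]_q => 1 + sq y).
  by apply: qgrowthD; [exact: qgrowth_cst|exact: qgrowth_sq].
have K0 : 0 <= K by apply: Rintegral_ge0 => y _; rewrite addr_ge0// sq_ge0.
exists (C * K) => [|x]; first exact: mulr_ge0.
have qx := qgrowth_slice x qF.
apply: le_trans (le_normr_Rintegral _ _) _ => //; first exact: integrable_qgrowth.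
have -> : C * K * (1 + sq x) = \int[gaussian q]_y (C * (1 + sq x) * (1 + sq y)).
  rewrite RintegralZl//; last exact: integrable_qgrowth.
  by rewrite -/K mulrAC.
apply: le_Rintegral => //.
- have [mx _] := qx; apply: integrable_qgrowth; split; first exact: measurableT_comp.
  by have [_ [D D0 HD]] := qx; exists D => // y; rewrite normr_id.
- by apply: integrable_qgrowth; apply: qgrowthZ.
move=> y _; rewrite (le_trans (FC _))// -mulrA ler_wpM2l// sq_col_mx.
by have := sq_ge0 x; have := sq_ge0 y; nra.
Qed.

Lemma Rintegral_split p q (F : 'cV[R]_(p + q) -> R) : qgrowth F ->
  \int[gaussian (p + q)]_x F x = \int[gaussian p]_x \int[gaussian q]_y F (col_mx x y).
Proof.
move=> qF; have := integrable_qgrowth qF => /integrableP[mF _].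
apply: EFin_inj; rewrite EFin_Rintegral// EFin_Rintegral; last exact: qgrowth_expectation.
have iF := integrable_split qF.
transitivity (\int[pushforward (gaussian p \x gaussian q) (@cat_column p q)]_x (F x)%:E)%E.
  by apply: eq_measure_integral => A mA _; exact: gaussian_split.
rewrite integral_pushforward//= -integral12_prod_meas1//.
apply: eq_integral => x _; rewrite EFin_Rintegral//; exact: qgrowth_slice.
Qed.

Lemma integral_gaussian_rho1 (g : 'cV[R]_1 -> R) : qgrowth g ->
  (\int[gaussian 1]_x (g x)%:E = \int[leb]_t ((rho1 t)%:E * (g t%:M)%:E))%E.
Proof.
move=> [mg _].
have key (h : 'cV[R]_1 -> \bar R) : measurable_fun setT h -> (forall x, 0 <= h x)%E ->
    (\int[gaussian 1]_x h x = \int[leb]_t ((rho1 t)%:E * h t%:M))%E.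
  move=> mh h0; rewrite (@ge0_integral_gaussianS _ 0 h)//; apply: eq_integral => t _.
  rewrite integral_dirac//; last exact: (@measurable_slice _ 1).
  rewrite diracT mul1e; congr (_ * h _)%E; apply/colP => i.
  rewrite ord1 -(col_mxEu t%:M (0 : 'cV[R]_0) 0).
  by congr (col_mx t%:M (0 : 'cV[R]_0) _ _); exact: val_inj.
have mg' : measurable_fun setT (EFin \o g) by exact/measurable_EFinP.
rewrite integralE [RHS]integralE !key//; last 2 first.
- by apply: measurable_funeneg; exact: mg'.
- by apply: measurable_funepos; exact: mg'.
have r0 t : 0 <= rho1 t :> R by rewrite ltW// rho1_gt0.
congr (_ - _)%E; apply: eq_integral => t _.
  by rewrite !funeposE maxe_pMr ?mule0 ?lee_fin.
by rewrite !funenegE -muleN maxe_pMr ?mule0 ?lee_fin.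
Qed.

(** The bridge from the iterated integrals of the statement to the measure [gaussian]. The inner
    integral is finite for every value of the first coordinate, so it can be treated as a real
    function and the induction hypothesis applies to each slice. *)
Lemma gint_qgrowth m (F : 'cV[R]_m -> R) : qgrowth F ->
  gint (fun x => (F x)%:E) = (\int[gaussian m]_x (F x)%:E)%E.
Proof.
elim: m F => [|m IH] F qF.
  by rewrite /= integral_dirac ?diracT ?mul1e//; apply/measurable_EFinP; case: qF.
rewrite -[in RHS]EFin_Rintegral// (@Rintegral_split 1 m)// EFin_Rintegral; last first.
  exact: qgrowth_expectation.
rewrite integral_gaussian_rho1; last exact: (@qgrowth_expectation 1 m).
apply: eq_integral => t _; congr (_ * _)%E.
have qt := @qgrowth_slice _ 1 m F t%:M qF.
by apply: etrans (IH _ qt) _; rewrite EFin_Rintegral.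
Qed.

Lemma greal_qgrowth m (F : 'cV[R]_m -> R) : qgrowth F ->
  greal F = \int[gaussian m]_x F x.
Proof. by move=> qF; rewrite /greal gint_qgrowth. Qed.

End gaussian_product.

(** * Invariance under orthogonal maps *)

Section gaussian_invariance.
Context {R : realType}.
Local Notation leb := (@lebesgue_measure R).
Local Notation mR := (measurableTypeR R).

Definition affine (a b : R) (t : mR) : mR := a * t + b.

Lemma measurable_affine a b : measurable_fun setT (affine a b).
Proof. by apply: measurable_funD => //; exact: measurable_funM. Qed.

HB.instance Definition _ a b := isMeasurableFun.Build _ _ _ _
  (affine a b) (@measurable_affine a b).

(** Lebesgue measure is determined by its values on half-open intervals, whose preimages under
    [affine a b] are intervals shorter by the factor [a]. *)
Lemma lebesgue_measure_affine (a b : R) (A : set mR) : 0 < a -> measurable A ->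
  leb A = (a%:E * leb (affine a b @^-1` A))%E.
Proof.
move=> a0 mA.
apply: (lebesgue_measure_unique
  (mu := mscale (NngNum (ltW a0)) (pushforward leb (affine a b)))) => //.
move=> _ [[u v]] _ <-.
rewrite /= /mscale/= /pushforward/=.
have -> : affine a b @^-1` `]u, v] = `](u - b) / a, (v - b) / a]%classic.
  have E (t : R) : (t \in `](u - b) / a, (v - b) / a]) = (a * t + b \in `]u, v]).
    by rewrite !in_itv/= ltr_pdivrMr// ler_pdivlMr// ltrBlDr lerBrDr mulrC.
  by apply/funext => t; rewrite /mkset /preimage/= -E.
rewrite !lebesgue_measure_itv/= !lte_fin ltr_pM2r ?invr_gt0// ltrD2r.
case: ifP => _; last by rewrite mule0.
rewrite -!EFinB -EFinM; congr EFin; field.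
by rewrite gt_eqF.
Qed.

Lemma ge0_integral_affine (a b : R) (F : mR -> \bar R) : a != 0 ->
  measurable_fun setT F -> (forall t, 0 <= F t)%E ->
  (\int[leb]_t F t = `|a|%:E * \int[leb]_t F (affine a b t))%E.
Proof.
move=> a0 mF F0.
have pos c d (G : mR -> \bar R) : 0 < c -> measurable_fun setT G ->
    (forall t, 0 <= G t)%E ->
    (\int[leb]_t G t = c%:E * \int[leb]_t G (affine c d t))%E.
  move=> c0 mG G0.
  have := ge0_integral_pushforward (measurable_affine c d) leb (D := setT)
    measurableT mG (fun y _ => G0 y).
  rewrite preimage_setT => <-.
  rewrite -[c]/((NngNum (ltW c0))%:num) -ge0_integral_mscale//.
  apply: eq_measure_integral => A mA _; exact: (lebesgue_measure_affine d c0 mA).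
have [an|ap|/eqP] := ltgtP a 0; last by rewrite (negbTE a0).
(* A negative slope is first reflected: [t -> -t] preserves Lebesgue measure, and
   [a t + b = -((-a) t - b)] reduces to the positive slope [-a]. *)
- transitivity (\int[leb]_t F (affine (-1) 0 t))%E.
    have E : affine (-1) 0 = -%R :> (mR -> mR).
      by apply/funext => t; rewrite /affine mulN1r addr0.
    have := ge0_integral_pushforward (measurable_affine (-1) 0) leb (D := setT)
      measurableT mF (fun y _ => F0 y).
    rewrite preimage_setT => <-.
    by apply: eq_measure_integral => A mA _; rewrite /= E lebesgue_measureN.
  rewrite ltr0_norm// (pos (- a) (- b))//; last 2 first.
  - by rewrite oppr_gt0.
  - exact: (measurableT_comp mF (measurable_affine _ _)).
  by congr (_ * _)%E; apply: eq_integral => t _; congr F; rewrite /affine; ring.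
- by rewrite gtr0_norm//; exact: pos.
Qed.

Definition density m (x : 'cV[R]_m) : R := \prod_i rho1 (x i 0).

Lemma density_gt0 m (x : 'cV[R]_m) : 0 < density x.
Proof. by apply: prodr_gt0 => i _; exact: rho1_gt0. Qed.

Lemma densityE m (x : 'cV[R]_m) :
  density x = (Num.sqrt (2 * pi)) ^- m * expR (- sq x / 2).
Proof.
rewrite /density /sq /rho1 big_split/= prodr_const card_ord exprVn mulrC.
congr (_ * _); rewrite -expR_sum -mulr_suml -sumrN.
by [].
Qed.

Lemma measurable_density m : measurable_fun setT (@density m).
Proof.
apply: measurable_prod => i _.
exact: (measurableT_comp measurable_rho1 (measurable_coor i)).
Qed.

Lemma density_col_mx m t (y : 'cV[R]_m) : density (col_mx t%:M y) = rho1 t * density y.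
Proof.
rewrite /density big_split_ord/= big_ord1 col_mxEu mxE eqxx mulr1n; congr (_ * _).
by apply: eq_bigr => i _; rewrite col_mxEd.
Qed.

(* The Lebesgue integral on R^m, written with the Gaussian as reference measure. *)
Definition lint m (F : 'cV[R]_m -> \bar R) : \bar R :=
  (\int[gaussian m]_x ((density x)^-1%:E * F x))%E.

Lemma measurable_densityV m : measurable_fun setT (fun x : 'cV[R]_m => (density x)^-1%:E).
Proof.
apply/measurable_EFinP.
rewrite (_ : (fun _ => _) =
  fun x : 'cV[R]_m => Num.sqrt (2 * pi) ^+ m * expR (sq x * 2^-1)); last first.
  by apply/funext => x; rewrite densityE invfM invrK -expRN mulNr opprK.
apply: measurable_funM => //; apply: measurableT_comp => //.
by apply: measurable_funM => //; exact: measurable_sq.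
Qed.

End gaussian_invariance.

(** * Linear changes of variables for the Lebesgue integral *)

Section lebesgue_iterated.
Context {R : realType}.
Local Notation leb := (@lebesgue_measure R).
Local Notation mR := (measurableTypeR R).

Lemma measurable_linear_column p q (A : 'M[R]_(p, q)) b :
  measurable_fun setT (fun x : 'cV[R]_q => A *m x + b).
Proof.
apply: measurable_fun_coorP => i; under eq_fun do rewrite !mxE.
apply: measurable_funD => //; apply: measurable_sum => j.
by apply: measurable_funM => //; exact: measurable_coor.
Qed.

Lemma measurable_mulmx_column p q (A : 'M[R]_(p, q)) :
  measurable_fun setT (fun x : 'cV[R]_q => A *m x).
Proof. by under eq_fun do rewrite -[_ *m _]addr0; exact: measurable_linear_column. Qed.

Lemma density_weight_ge0 m (F : 'cV[R]_m -> \bar R) x :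
  (0 <= F x -> 0 <= (density x)^-1%:E * F x)%E.
Proof. by move=> F0; rewrite mule_ge0// lee_fin invr_ge0 ltW// density_gt0. Qed.

Lemma measurable_density_weight m (F : 'cV[R]_m -> \bar R) :
  measurable_fun setT F -> measurable_fun setT (fun x => (density x)^-1%:E * F x)%E.
Proof. by move=> mF; apply: emeasurable_funM => //; exact: measurable_densityV. Qed.

Lemma lintS m (F : 'cV[R]_(1 + m) -> \bar R) :
  measurable_fun setT F -> (forall x, 0 <= F x)%E ->
  (lint F = \int[leb]_t lint (fun y => F (col_mx t%:M y)))%E.
Proof.
move=> mF F0; rewrite /lint (@ge0_integral_gaussianS _ m)//; last 2 first.
- exact: measurable_density_weight.
- by move=> x; exact: density_weight_ge0.
have r0 t : 0 < rho1 t :> R by exact: rho1_gt0.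
apply: eq_integral => t _; rewrite -ge0_integralZl//; last 3 first.
- apply: (@measurable_slice _ 1 m _ _ (fun x => (density x)^-1%:E * F x)%E).
  exact: measurable_density_weight.
- by move=> y _; exact: (@density_weight_ge0 (1 + m)).
- by rewrite lee_fin ltW.
apply: eq_integral => y _; rewrite muleA -EFinM density_col_mx.
by congr (_%:E * _)%E; field; rewrite !gt_eqF// density_gt0.
Qed.

Lemma measurable_lint_slice m (F : 'cV[R]_(1 + m) -> \bar R) :
  measurable_fun setT F -> (forall x, 0 <= F x)%E ->
  measurable_fun [set: mR] (fun t => lint (fun y => F (col_mx t%:M y))).
Proof.
move=> mF F0; rewrite /lint.
apply: (@measurable_fun_fubini_tonelli_F _ _ _ _ _ (gaussian m)
  (fun z : mR * 'cV[R]_m => (density z.2)^-1%:E * F (col_mx z.1%:M z.2))%E).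
  apply: emeasurable_funM.
    exact: (measurableT_comp (@measurable_densityV R m)).
  exact: (measurableT_comp mF (@measurable_cons_column R m)).
by move=> z; exact: (@density_weight_ge0 m (fun=> F _)).
Qed.

(** Tonelli puts the first coordinate innermost, which is the order suited to upper shears; [lintS]
    suits lower ones. *)
Lemma lintS_swap m (F : 'cV[R]_(1 + m) -> \bar R) :
  measurable_fun setT F -> (forall x, 0 <= F x)%E ->
  (lint F = lint (fun y => \int[leb]_t F (col_mx t%:M y)))%E.
Proof.
move=> mF F0; rewrite lintS// /lint.
have mz : measurable_fun setT (fun z : mR * 'cV[R]_m =>
    (density z.2)^-1%:E * F (col_mx z.1%:M z.2))%E.
  apply: emeasurable_funM.
    exact: (measurableT_comp (@measurable_densityV R m)).
  exact: (measurableT_comp mF (@measurable_cons_column R m)).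
rewrite (@fubini_tonelli _ _ _ _ _ leb (gaussian m) _ mz); last first.
  by move=> z; exact: (@density_weight_ge0 m (fun=> F _)).
apply: eq_integral => y _ /=; rewrite ge0_integralZl//.
- apply: (measurableT_comp (f := F)) => //; apply: measurable_col_mx => //.
  exact: measurable_scalar_column.
- by rewrite lee_fin invr_ge0 ltW// density_gt0.
Qed.

Lemma lint_translation m (F : 'cV[R]_m -> \bar R) b :
  measurable_fun setT F -> (forall x, 0 <= F x)%E ->
  lint (fun x => F (x + b)) = lint F.
Proof.
elim: m F b => [|m IH]; last rewrite -[m.+1]/(1 + m)%N => F b mF F0.
  by move=> F b _ _; congr lint; apply/funext => x; congr F; apply/colP => -[].
have mFb : measurable_fun setT (fun x : 'cV[R]_(1 + m) => F (x + b)).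
  have -> : (fun x : 'cV[R]_(1 + m) => F (x + b)) = fun x => F (1%:M *m x + b).
    by apply/funext => x; rewrite mul1mx.
  by apply: (measurableT_comp (f := F)) => //; exact: measurable_linear_column.
rewrite lintS// [RHS]lintS//.
rewrite -[b]vsubmxK; set c := usubmx b; set d := dsubmx b.
rewrite [RHS](@ge0_integral_affine _ 1 (c 0 0)) ?oner_neq0//; last 2 first.
- exact: measurable_lint_slice.
- by move=> t; apply: integral_ge0 => y _; exact: (@density_weight_ge0 m (fun=> F _)).
rewrite normr1 mul1e; apply: eq_integral => t _.
rewrite -[RHS](IH _ d)//; last exact: measurable_slice.
congr lint; apply/funext => y; congr F; rewrite add_col_mx; congr col_mx.
by apply/colP => i; rewrite !mxE !ord1 eqxx !mulr1n /affine mul1r.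
Qed.

(** The change of variables formula for [A]. It is multiplicative in [A], so elementary factors
    suffice. *)
Definition lint_scales m (A : 'M[R]_m) := forall F : 'cV[R]_m -> \bar R,
  measurable_fun setT F -> (forall x, 0 <= F x)%E ->
  (`|\det A|%:E * lint (fun x => F (A *m x)) = lint F)%E.

Lemma lint_scalesM m (A B : 'M[R]_m) :
  lint_scales A -> lint_scales B -> lint_scales (A *m B).
Proof.
move=> hA hB F mF F0; rewrite det_mulmx normrM EFinM -[RHS](hA F)// -muleA; congr (_ * _)%E.
rewrite -(hB (fun x => F (A *m x)))//; last first.
  by apply: (measurableT_comp (f := F)) => //; exact: measurable_mulmx_column.
by congr (_ * lint _)%E; apply/funext => x; rewrite mulmxA.
Qed.

(** With the first coordinate [t] fixed, the shear translates the remaining ones by [c t]. *)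
Lemma lint_scales_lower m (c : 'cV[R]_m) :
  lint_scales (block_mx (1%:M : 'M[R]_1) 0 c 1%:M).
Proof.
move=> F mF F0; rewrite det_lblock !det1 mulr1 normr1 mul1e.
rewrite lintS//; last first.
  by apply: (measurableT_comp (f := F)) => //; exact: measurable_mulmx_column.
rewrite [RHS]lintS//; apply: eq_integral => t _.
rewrite -[RHS](@lint_translation _ _ (c *m t%:M))//; last exact: measurable_slice.
congr lint; apply/funext => y; congr F.
by rewrite mul_block_col !mul1mx mul0mx addr0 addrC.
Qed.

(** With the remaining coordinates [y] fixed, the shear translates the first one by [b y]. *)
Lemma lint_scales_upper m (b : 'rV[R]_m) :
  lint_scales (block_mx (1%:M : 'M[R]_1) b 0 1%:M).
Proof.
move=> F mF F0; rewrite det_ublock !det1 mulr1 normr1 mul1e.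
rewrite lintS_swap//; last first.
  by apply: (measurableT_comp (f := F)) => //; exact: measurable_mulmx_column.
rewrite [RHS]lintS_swap//; congr lint; apply/funext => y.
rewrite [RHS](@ge0_integral_affine _ 1 ((b *m y) 0 0)) ?oner_neq0//; last first.
- apply: (measurableT_comp (f := F)) => //; apply: measurable_col_mx => //.
  exact: measurable_scalar_column.
rewrite normr1 mul1e; apply: eq_integral => t _; congr F.
rewrite mul_block_col !mul1mx mul0mx add0r; congr col_mx.
by apply/colP => i; rewrite !ord1 !mxE eqxx !mulr1n /affine mul1r.
Qed.

Lemma lint_scales_diag m a (D : 'M[R]_m) : a != 0 -> lint_scales D ->
  lint_scales (block_mx (a%:M : 'M[R]_1) 0 0 D).
Proof.
move=> a0 hD F mF F0; rewrite det_ublock det_scalar expr1 normrM EFinM -muleA.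
have mFA : measurable_fun setT (fun x => F (block_mx (a%:M : 'M[R]_1) 0 0 D *m x)).
  by apply: (measurableT_comp (f := F)) => //; exact: measurable_mulmx_column.
have L0 (G : 'cV[R]_(1 + m) -> \bar R) t : (forall x, 0 <= G x)%E ->
    (0 <= lint (fun y => G (col_mx t%:M y)))%E.
  by move=> G0; apply: integral_ge0 => y _; exact: (@density_weight_ge0 m (fun=> G _)).
rewrite lintS// -ge0_integralZl//; last 2 first.
- exact: (measurable_lint_slice mFA).
- by move=> t _; exact: (L0 (fun x => F (_ *m x))).
rewrite [RHS]lintS// [RHS](@ge0_integral_affine _ a 0)//; last 2 first.
- exact: measurable_lint_slice.
- by move=> t; exact: L0.
congr (_ * _)%E; apply: eq_integral => t _.
rewrite -[RHS](hD (fun y => F (col_mx (affine a 0 t)%:M y)))//; last exact: measurable_slice.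
congr (_ * lint _)%E; apply/funext => y; congr F.
rewrite mul_block_col !mul0mx addr0 add0r; congr col_mx.
by apply/colP => i; rewrite !ord1 !mxE big_ord1 !mxE eqxx !mulr1n /affine addr0.
Qed.

(** One elimination step: lower shear times block diagonal times upper shear, where [D'] is the
    Schur complement of the pivot [a]. It inherits invertibility through the determinant. *)
Lemma lint_scales_pivot m a (b : 'rV[R]_m) (c : 'cV[R]_m) (D : 'M[R]_m) :
  (forall D' : 'M[R]_m, D' \in unitmx -> lint_scales D') ->
  block_mx (a%:M : 'M[R]_1) b c D \in unitmx -> a != 0 ->
  lint_scales (block_mx (a%:M : 'M[R]_1) b c D).
Proof.
move=> IH Au a0; pose D' := D - a^-1 *: (c *m b).
have AE : block_mx (a%:M : 'M[R]_1) b c D =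
    block_mx (1%:M : 'M[R]_1) 0 (a^-1 *: c) 1%:M *m block_mx (a%:M : 'M[R]_1) 0 0 D' *m
    block_mx (1%:M : 'M[R]_1) (a^-1 *: b) 0 1%:M.
  rewrite !mulmx_block !(mul1mx, mul0mx, mulmx1, mulmx0, addr0, add0r).
  rewrite -!scalemxAl !mul_mx_scalar !scalerA mulVf// !scale1r.
  congr block_mx; first by rewrite mul_scalar_mx scalerA mulfV// scale1r.
  by rewrite -scalemxAr -scalemxAl !scalerA mulVf// ?mulr1 ?mul1r /D' addrC subrK.
have D'u : D' \in unitmx.
  move: Au; rewrite AE !unitmx_mul => /andP[/andP[_ +] _].
  by rewrite unitmxE det_ublock unitrM => /andP[_]; rewrite -unitmxE.
rewrite AE; apply: lint_scalesM; last exact: lint_scales_upper.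
apply: lint_scalesM; first exact: lint_scales_lower.
by apply: lint_scales_diag => //; exact: IH.
Qed.

Lemma lint_scales_unitmx m (A : 'M[R]_m) : A \in unitmx -> lint_scales A.
Proof.
elim: m A => [A _ F _ _|m IH]; last rewrite -[m.+1]/(1 + m)%N => A Au.
  rewrite det_mx00 normr1 mul1e; congr lint; apply/funext => x; congr F.
  by apply/colP => -[].
pose a := ulsubmx A 0 0.
have AE : A = block_mx (a%:M : 'M[R]_1) (ursubmx A) (dlsubmx A) (drsubmx A).
  rewrite -[LHS]submxK; congr block_mx.
  by apply/matrixP => i j; rewrite [RHS]mxE !ord1 eqxx mulr1n.
have [a0|a0] := eqVneq a 0; last first.
  by move: Au; rewrite AE => Au; exact: (lint_scales_pivot IH Au a0).
(* A zero pivot above a zero column would make the determinant vanish. *)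
have [c0|/eqP] := eqVneq (dlsubmx A) 0.
  move: Au; rewrite AE c0 a0 unitmxE det_ublock det_scalar expr1 mul0r.
  by rewrite unitr0.
move=> c0.
have [i ci] : exists i, dlsubmx A i 0 != 0.
  apply: contrapT => h; apply: c0; apply/colP => i; rewrite [RHS]mxE.
  by apply: contrapT => /eqP ci; apply: h; exists i.
(* A zero pivot is made nonzero by adding row i to the first row. *)
pose S s := block_mx (1%:M : 'M[R]_1) (s *: delta_mx 0 i : 'rV[R]_m) 0 1%:M.
have SS : S (-1) *m (S 1 *m A) = A.
  rewrite mulmxA /S mulmx_block !(mul1mx, mul0mx, mulmx1, mulmx0, addr0, add0r).
  by rewrite -scalerDl subrr scale0r -scalar_mx_block mul1mx.
rewrite -SS; apply: lint_scalesM; first exact: lint_scales_upper.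
have Su : S 1 *m A \in unitmx.
  by rewrite unitmx_mul Au andbT unitmxE det_ublock !det1 mulr1 unitr1.
move: Su; rewrite [in S 1 *m A]AE /S mulmx_block !(mul1mx, mul0mx, addr0, add0r).
rewrite scale1r a0.
have -> : 0%:M + delta_mx 0 i *m dlsubmx A = (dlsubmx A i 0)%:M :> 'M[R]_1.
  rewrite -rowE; apply/matrixP => k l; rewrite !ord1 [LHS]mxE [RHS]mxE.
  by rewrite [X in X + _]mxE [X in _ + X]mxE eqxx mul0rn add0r mulr1n.
by move=> Su; exact: (lint_scales_pivot IH Su ci).
Qed.

Lemma sq_orthogonal p m (Q : 'M[R]_(p, m)) x : Q^T *m Q = 1%:M -> sq (Q *m x) = sq x.
Proof. by move=> QQ; rewrite !sq_trmx trmx_mul mulmxA -(mulmxA x^T) QQ mulmx1. Qed.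

(** An orthogonal map has determinant of absolute value 1 and preserves [density], which depends on
    [x] only through [sq x]. *)
Lemma ge0_integral_orthogonal m (Q : 'M[R]_m) (F : 'cV[R]_m -> \bar R) :
  Q^T *m Q = 1%:M -> measurable_fun setT F -> (forall x, 0 <= F x)%E ->
  (\int[gaussian m]_x F (Q *m x) = \int[gaussian m]_x F x)%E.
Proof.
move=> QQ mF F0.
have Qu : Q \in unitmx by have [] := mulmx1_unit QQ.
have dQ : `|\det Q| = 1.
  have : (\det Q) ^+ 2 = 1 by rewrite expr2 -{1}det_tr -det_mulmx QQ det1.
  by move/eqP; rewrite sqrf_eq1 => /orP[]/eqP ->; rewrite ?normrN normr1.
have weight (G : 'cV[R]_m -> \bar R) : (\int[gaussian m]_x G x)%E =
    lint (fun x => (density x)%:E * G x)%E.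
  apply: eq_integral => x _; rewrite muleA -EFinM mulVf ?mul1e//.
  by rewrite gt_eqF// density_gt0.
rewrite !weight -[RHS](lint_scales_unitmx Qu)//; last 2 first.
- apply: emeasurable_funM => //; apply/measurable_EFinP; exact: measurable_density.
- by move=> x; rewrite mule_ge0// lee_fin ltW// density_gt0.
rewrite dQ mul1e; congr lint; apply/funext => x.
by rewrite !densityE sq_orthogonal.
Qed.

Lemma sqr_sum_le N (a : nat -> R) :
  (\sum_(j < N) a j) ^+ 2 <= N%:R * \sum_(j < N) a j ^+ 2.
Proof.
elim: N => [|N IH]; first by rewrite !big_ord0 expr0n mulr0.
rewrite !big_ord_recr/=; have [N0|N0] := posnP N.
  by rewrite N0 !big_ord0 !add0r mul1r.
set S := \sum_(j < N) a j in IH *; set T := \sum_(j < N) _ in IH *.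
rewrite -natr1; have {}N0 : 0 < N%:R :> R by rewrite ltr0n.
rewrite -subr_ge0 -(pmulr_rge0 _ N0).
(* [N] times the gap equals [(S - N a_N)^2 + (N + 1)(N T - S^2)]. *)
have := sqr_ge0 (S - N%:R * a N); have := ler_wpM2l (ltW N0) IH; nra.
Qed.

(** The crude factor [m] is harmless, since the bound serves only to show quadratic growth. *)
Lemma sq_mulmx_le p m (Q : 'M[R]_(p, m)) (x : 'cV[R]_m) :
  sq (Q *m x) <= m%:R * (\sum_i \sum_j Q i j ^+ 2) * sq x.
Proof.
rewrite -mulrA mulr_suml mulr_sumr; apply: ler_sum => i _; rewrite mxE.
(* [inord] needs a nonempty index type; it turns the summand into a function on [nat], the form that
   [sqr_sum_le] takes. *)
case: m Q x => [|m] Q x; first by rewrite big_ord0 expr0n mul0r.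
have E (F : 'I_m.+1 -> R) : \sum_j F j = \sum_(j < m.+1) F (inord j).
  by apply: eq_bigr => j _; rewrite inord_val.
rewrite E (le_trans (sqr_sum_le _ (fun j => Q i (inord j) * x (inord j) 0)))//.
rewrite ler_wpM2l// mulr_suml [leRHS]E; apply: ler_sum => j _.
rewrite exprMn ler_wpM2l ?sqr_ge0// /sq (bigD1 (inord j))//= lerDl.
by apply: sumr_ge0 => k _; exact: sqr_ge0.
Qed.

Lemma qgrowth_mulmx p m (F : 'cV[R]_p -> R) (Q : 'M[R]_(p, m)) :
  qgrowth F -> qgrowth (fun x => F (Q *m x)).
Proof.
move=> [mF [C C0 FC]]; split.
  by apply: (measurableT_comp (f := F)) => //; exact: measurable_mulmx_column.
pose K := m%:R * \sum_i \sum_j Q i j ^+ 2.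
have K0 : 0 <= K.
  by rewrite mulr_ge0// sumr_ge0// => i _; rewrite sumr_ge0// => j _; exact: sqr_ge0.
exists (C * (1 + K)); first by rewrite mulr_ge0// addr_ge0.
move=> x; rewrite (le_trans (FC _))// -mulrA ler_wpM2l//.
by have := sq_mulmx_le Q x; rewrite -/K; have := sq_ge0 x; nra.
Qed.

Lemma Rintegral_orthogonal m (Q : 'M[R]_m) (F : 'cV[R]_m -> R) :
  Q^T *m Q = 1%:M -> qgrowth F ->
  \int[gaussian m]_x F (Q *m x) = \int[gaussian m]_x F x.
Proof.
move=> QQ qF; have [mF _] := qF.
have mF' : measurable_fun setT (EFin \o F) by exact/measurable_EFinP.
rewrite /Rintegral integralE [in RHS]integralE; congr (fine (_ - _)%E).
  rewrite -[RHS](ge0_integral_orthogonal QQ)//; last exact: measurable_funepos.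
  by apply: eq_integral => x _; rewrite !funeposE.
rewrite -[RHS](ge0_integral_orthogonal QQ)//; last exact: measurable_funeneg.
by apply: eq_integral => x _; rewrite !funenegE.
Qed.

End lebesgue_iterated.

(** * Expectations *)

Section expectation.
Context {R : realType}.

Lemma ExpD m (F G : 'cV[R]_m -> R) : qgrowth F -> qgrowth G ->
  \int[gaussian m]_x (F x + G x) = \int[gaussian m]_x F x + \int[gaussian m]_x G x.
Proof. by move=> qF qG; rewrite RintegralD//; exact: integrable_qgrowth. Qed.

Lemma ExpZ m a (F : 'cV[R]_m -> R) : qgrowth F ->
  \int[gaussian m]_x (a * F x) = a * \int[gaussian m]_x F x.
Proof. by move=> qF; rewrite RintegralZl//; exact: integrable_qgrowth. Qed.

Lemma ExpB m (F G : 'cV[R]_m -> R) : qgrowth F -> qgrowth G ->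
  \int[gaussian m]_x (F x - G x) = \int[gaussian m]_x F x - \int[gaussian m]_x G x.
Proof. by move=> qF qG; rewrite RintegralB//; exact: integrable_qgrowth. Qed.

Lemma Exp_cst m (c : R) : \int[@gaussian R m]_x c = c.
Proof.
rewrite (_ : (fun=> c) = cst c)// Rintegral_cst// (_ : fine _ = 1) ?mulr1//.
by rewrite (_ : _ [set: _] = 1%E)//; exact: (probability_setT (gaussian m)).
Qed.

Lemma Exp_le m (F G : 'cV[R]_m -> R) : qgrowth F -> qgrowth G ->
  (forall x, F x <= G x) -> \int[gaussian m]_x F x <= \int[gaussian m]_x G x.
Proof. by move=> qF qG FG; apply: le_Rintegral => //; exact: integrable_qgrowth. Qed.

Lemma Exp_ge0 m (F : 'cV[R]_m -> R) : (forall x, 0 <= F x) -> 0 <= \int[gaussian m]_x F x.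
Proof. by move=> F0; apply: Rintegral_ge0. Qed.

Lemma Exp_sum m (I : Type) (r : seq I) (F : I -> 'cV[R]_m -> R) :
  (forall i, qgrowth (F i)) ->
  \int[gaussian m]_x (\sum_(i <- r) F i x) = \sum_(i <- r) \int[gaussian m]_x F i x.
Proof.
move=> qF; elim: r => [|i r IH].
  by under eq_Rintegral do rewrite big_nil; rewrite big_nil Exp_cst.
under eq_Rintegral do rewrite big_cons.
by rewrite big_cons ExpD ?IH//; exact: qgrowth_sum.
Qed.

Lemma qgrowth_lim m (F : nat -> 'cV[R]_m -> R) (G H : 'cV[R]_m -> R) :
  (forall n, measurable_fun setT (F n)) -> qgrowth H ->
  (forall n x, `|F n x| <= H x) -> (forall x, F n x @[n --> \oo] --> G x) ->
  qgrowth G.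
Proof.
move=> mF qH FH FG; apply: (@qgrowth_le _ _ _ H) => //.
  apply: (measurable_fun_cvg (h := F)) => // x _; exact: FG.
move=> x; have C : `|F n x| @[n --> \oo] --> `|G x| by exact: cvg_norm.
rewrite -(cvg_lim _ C)//.
by apply: limr_le; [exact: cvgP C|apply: nearW => n; exact: FH].
Qed.

(** Dominated convergence with a majorant of quadratic growth. All derivatives below are taken along
    the sequence [1/(n+1)] in order to fit this form. *)
Lemma Exp_lim m (F : nat -> 'cV[R]_m -> R) (G H : 'cV[R]_m -> R) :
  (forall n, measurable_fun setT (F n)) -> qgrowth H ->
  (forall n x, `|F n x| <= H x) -> (forall x, F n x @[n --> \oo] --> G x) ->
  \int[gaussian m]_x F n x @[n --> \oo] --> \int[gaussian m]_x G x.
Proof.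
move=> mF qH FH FG.
have qG := qgrowth_lim mF qH FH FG.
have qF n : qgrowth (F n) by apply: (@qgrowth_le _ _ _ H).
have [||||_ _ h] := @dominated_convergence _ _ _ (gaussian m) setT measurableT
  (fun n x => (F n x)%:E) (fun x => (G x)%:E) (fun x => (H x)%:E) _ _ _
  (integrable_qgrowth qH) _.
- by move=> n; apply/measurable_EFinP.
- by case: qG => mG _; apply/measurable_EFinP.
- apply: aeW => x _; apply: cvg_EFin; first exact: nearW.
  exact: FG.
- by apply: aeW => x n _; rewrite lee_fin.
by apply: fine_cvg; rewrite EFin_Rintegral.
Qed.

Lemma qgrowth_sqr m (a : 'cV[R]_m -> R) :
  measurable_fun setT a -> qgrowth (fun x => a x ^+ 2) -> qgrowth a.
Proof.
move=> ma qa; apply: (@qgrowth_le _ _ _ (fun x => 1 + a x ^+ 2)) => //.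
  by apply: qgrowthD => //; exact: qgrowth_cst.
move=> x; rewrite ler_norml.
by have := sqr_ge0 (a x - 1); have := sqr_ge0 (a x + 1); nra.
Qed.

(** Expand the nonnegative variance, the mean of [(a - c)^2] with [c] the mean of [a]. *)
Lemma Exp_jensen m (a : 'cV[R]_m -> R) :
  measurable_fun setT a -> qgrowth (fun x => a x ^+ 2) ->
  (\int[gaussian m]_x a x) ^+ 2 <= \int[gaussian m]_x (a x ^+ 2).
Proof.
move=> ma qa2; have qa := qgrowth_sqr ma qa2; set c := \int[gaussian m]_x a x.
have : 0 <= \int[gaussian m]_x (a x - c) ^+ 2 by apply: Exp_ge0 => x; exact: sqr_ge0.
rewrite (_ : (fun x => (a x - c) ^+ 2) =
    (fun x => a x ^+ 2 + (- (2 * c) * a x + c ^+ 2))); last first.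
  by apply/funext => x; ring.
have qc := qgrowth_cst m (c ^+ 2); have qca := qgrowthZ (- (2 * c)) qa.
rewrite ExpD//; last exact: qgrowthD.
by rewrite ExpD// ExpZ// Exp_cst -/c; nra.
Qed.

Lemma qgrowth_coorM m (i j : 'I_m) : qgrowth (fun x : 'cV[R]_m => x i 0 * x j 0).
Proof.
apply: (@qgrowth_le _ _ _ (fun x => 2 * sq x)).
- by apply: measurable_funM; exact: measurable_coor.
- by apply: qgrowthZ; exact: qgrowth_sq.
move=> x; have le l : x l 0 ^+ 2 <= sq x.
  by rewrite /sq (bigD1 l)//= lerDl; apply: sumr_ge0 => k _; exact: sqr_ge0.
have := le i; have := le j; rewrite ler_norml.
by have := sqr_ge0 (x i 0 + x j 0); have := sqr_ge0 (x i 0 - x j 0); nra.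
Qed.

(** The reflection [Q] of coordinate [i] is orthogonal and changes the sign of the product, so the
    mean equals its opposite. *)
Lemma Exp_coorM_neq m (i j : 'I_m) : i != j -> \int[gaussian m]_x (x i 0 * x j 0) = 0 :> R.
Proof.
move=> ij; pose Q : 'M[R]_m := diag_mx (\row_l (-1) ^+ (l == i)).
have QQ : Q^T *m Q = 1%:M.
  rewrite tr_diag_mx mulmx_diag; apply/matrixP => k l; rewrite !mxE.
  by case: (k == l); rewrite ?mulr0n// !mulr1n -expr2 sqrr_sign.
have := Rintegral_orthogonal QQ (qgrowth_coorM i j).
have E (x : 'cV[R]_m) l : (Q *m x) l 0 = (-1) ^+ (l == i) * x l 0.
  by rewrite mul_diag_mx !mxE.
under eq_Rintegral do rewrite !E eqxx (eq_sym j) (negbTE ij) expr1 expr0 mul1r mulN1r mulNr -mulN1r.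
rewrite ExpZ; last exact: qgrowth_coorM.
by set e := \int[_]_(_ in _) _; lra.
Qed.

Lemma Exp_coor_sqr_le m (i : 'I_m) : \int[@gaussian R m]_x (x i 0 ^+ 2) <= 1.
Proof.
have q : qgrowth (fun x : 'cV[R]_m => x i 0 ^+ 2).
  by under eq_fun do rewrite expr2; exact: qgrowth_coorM.
by rewrite -lee_fin EFin_Rintegral//; exact: moment2_coor.
Qed.

(** Expanding the squares, the mixed moments vanish and each second moment is at most 1. *)
Lemma Exp_sq_mulmx p m (M : 'M[R]_(p, m)) :
  \int[gaussian m]_x sq (M *m x) <= \sum_i \sum_j M i j ^+ 2.
Proof.
rewrite /sq Exp_sum; last first.
  move=> i; apply: (@qgrowth_le _ _ _ (fun x => sq (M *m x))).
  - apply: measurable_funX.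
    exact: (measurableT_comp (measurable_coor i) (measurable_mulmx_column M)).
  - by apply: qgrowth_mulmx; exact: qgrowth_sq.
  - move=> x; rewrite ger0_norm ?sqr_ge0// /sq (bigD1 i)//= lerDl.
    by apply: sumr_ge0 => k _; exact: sqr_ge0.
apply: ler_sum => i _.
have -> : (fun x : 'cV[R]_m => (M *m x) i 0 ^+ 2) =
    fun x => \sum_j \sum_l M i j * M i l * (x j 0 * x l 0).
  apply/funext => x; rewrite mxE expr2 mulr_suml; apply: eq_bigr => j _.
  by rewrite mulr_sumr; apply: eq_bigr => l _; ring.
have q j l : qgrowth (fun x : 'cV[R]_m => M i j * M i l * (x j 0 * x l 0)).
  by apply: qgrowthZ; exact: qgrowth_coorM.
rewrite Exp_sum; last by move=> j; exact: qgrowth_sum.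
apply: ler_sum => j _; rewrite Exp_sum// (bigD1 j)//= big1 => [|l lj]; last first.
  by rewrite ExpZ ?Exp_coorM_neq ?mulr0 1?eq_sym//; exact: qgrowth_coorM.
rewrite addr0 ExpZ; last exact: qgrowth_coorM.
rewrite -expr2 ler_piMr ?sqr_ge0//.
under eq_Rintegral do rewrite -expr2; exact: Exp_coor_sqr_le.
Qed.

End expectation.

(** * Lipschitz functions *)

Section lipschitz.
Context {R : realType}.

Lemma cvg_derive_seq (V : normedModType R) (g : V -> R) (x v : V) :
  derivable g x v ->
  n.+1%:R * (g (n.+1%:R^-1 *: v + x) - g x) @[n --> \oo] --> 'D_v g x.
Proof.
move=> dg; have /= := dg; rewrite -[cvg _]/(cvg _) => cg.
have h : (n.+1%:R^-1 : R) @[n --> \oo] --> (0 : R)^'.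
  move=> A; rewrite /dnbhs /within/= => A0.
  have h0 : \forall n \near \oo, (n.+1%:R^-1 : R) != 0 -> A (n.+1%:R^-1 : R).
    exact: (@cvg_harmonic R _ A0).
  change (\forall n \near \oo, A (n.+1%:R^-1 : R)).
  apply: filterS h0 => n; apply.
  by rewrite invr_eq0 pnatr_eq0.
have := cvg_comp _ _ h cg.
by apply: cvg_trans; apply: near_eq_cvg; apply: nearW => n /=; rewrite invrK.
Qed.

Lemma differentiable_derive_sum m (f : 'cV[R]_m -> R) x v :
  differentiable f x -> 'D_v f x = \sum_i v i 0 * partial f i x.
Proof.
move=> df; rewrite deriveE//.
have -> : v = \sum_i v i 0 *: delta_mx i 0.
  by rewrite [LHS]matrix_sum_delta; apply: eq_bigr => i _; rewrite big_ord1.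
rewrite linear_sum; apply: eq_bigr => i _; rewrite linearZ/= /partial deriveE//.
congr (_ * _); rewrite summxE (bigD1 i)//= big1 => [|j ji].
  by rewrite !mxE !eqxx addr0 mulr1.
by rewrite !mxE eq_sym (negbTE ji) mulr0.
Qed.

Section lipschitz_function.
Variables (m : nat) (f : 'cV[R]_m -> R) (L : R).
Hypothesis df : forall x, differentiable f x.
Hypothesis lipf : forall x y, `|f x - f y| <= L * enorm (x - y).

Lemma lip_sqr x y : (f x - f y) ^+ 2 <= L ^+ 2 * sq (x - y).
Proof.
rewrite -real_normK ?num_real//.
have -> : L ^+ 2 * sq (x - y) = (L * enorm (x - y)) ^+ 2.
  by rewrite exprMn sqr_sqrtr// sq_ge0.
by rewrite lerXn2r ?nnegrE// (le_trans _ (lipf x y)).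
Qed.

Lemma lip_ge0 : (0 < m)%N -> 0 <= L.
Proof.
move=> m0; pose i := Ordinal m0; have := lipf (delta_mx i 0) 0.
rewrite subr0 /enorm (bigD1 i)//= big1 => [|j ji]; last first.
  by rewrite !mxE (negbTE ji) expr0n.
by rewrite !mxE !eqxx expr1n addr0 sqrtr1 mulr1; exact: le_trans (normr_ge0 _).
Qed.

Lemma lip_continuous : continuous f.
Proof. by move=> x; exact: differentiable_continuous. Qed.

Lemma lip_measurable : measurable_fun setT f.
Proof. by apply: continuous_measurable_column; exact: lip_continuous. Qed.

Lemma qgrowth_lip_sqr : qgrowth (fun x => f x ^+ 2).
Proof.
apply: (@qgrowth_le _ _ _ (fun x => 2 * f 0 ^+ 2 + 2 * L ^+ 2 * sq x)).
- by apply: measurable_funX; exact: lip_measurable.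
- apply: qgrowthD; first exact: qgrowth_cst.
  by apply: qgrowthZ; exact: qgrowth_sq.
move=> x; rewrite ger0_norm ?sqr_ge0//.
have := lip_sqr x 0; rewrite subr0.
by have := sqr_ge0 (f x - 2 * f 0); nra.
Qed.

(** The direction may vary with [n]: the Lipschitz condition bounds the error in the quotient by [L]
    times the distance from [v_ n] to [v]. Rotations and the matrices [slice_mx] both produce such
    perturbed directions. *)
Lemma cvg_derive_lip x v (v_ : nat -> 'cV[R]_m) :
  sq (v_ n - v) @[n --> \oo] --> 0 ->
  n.+1%:R * (f (x + n.+1%:R^-1 *: v_ n) - f x) @[n --> \oo] --> 'D_v f x.
Proof.
move=> vv; have dfv : derivable f x v by exact: diff_derivable.
have := cvg_derive_seq dfv => h.
have {}h : n.+1%:R * (f (x + n.+1%:R^-1 *: v) - f x) @[n --> \oo] --> 'D_v f x.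
  by under eq_fun do rewrite (addrC x).
pose e n := n.+1%:R * (f (x + n.+1%:R^-1 *: v_ n) - f (x + n.+1%:R^-1 *: v)).
suff e0 : e n @[n --> \oo] --> 0.
  have -> : (fun n => n.+1%:R * (f (x + n.+1%:R^-1 *: v_ n) - f x)) =
      (fun n => e n + n.+1%:R * (f (x + n.+1%:R^-1 *: v) - f x)).
    by apply/funext => n; rewrite /e -mulrDr; congr (_ * _); ring.
  by rewrite -['D_v f x]add0r; exact: cvgD.
have ele n : e n ^+ 2 <= L ^+ 2 * sq (v_ n - v).
  rewrite exprMn; have := lip_sqr (x + n.+1%:R^-1 *: v_ n) (x + n.+1%:R^-1 *: v).
  rewrite opprD addrACA subrr add0r -scalerBr sqZ exprVn.
  move=> /(ler_wpM2l (sqr_ge0 n.+1%:R)) /le_trans; apply.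
  by rewrite [leLHS]mulrCA mulVKf// expf_neq0.
have {}vv : L ^+ 2 * sq (v_ n - v) @[n --> \oo] --> (0 : R).
  by rewrite -(mulr0 (L ^+ 2)); apply: cvgMr.
apply/cvgr0Pnorm_le => _/posnumP[d]; near=> n.
rewrite -(@ler_pXn2r _ 2)// ?nnegrE// real_normK ?num_real// (le_trans (ele n))//.
near: n.
move/cvgrPdist_le : vv => /(_ (d%:num ^+ 2) _)[//|N _ HN].
exists N => // n /HN /=; rewrite sub0r normrN; apply: le_trans; exact: ler_norm.
Unshelve. all: by end_near. Qed.

Lemma derive_lip x v : ('D_v f x) ^+ 2 <= L ^+ 2 * sq v.
Proof.
have dfv : derivable f x v by exact: diff_derivable.
have h := cvg_derive_seq dfv.
have {}h : (n.+1%:R * (f (n.+1%:R^-1 *: v + x) - f x)) ^+ 2 @[n --> \oo] -->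
    ('D_v f x) ^+ 2.
  by under eq_fun do rewrite expr2; rewrite expr2; exact: cvgM.
rewrite -(cvg_lim _ h)//; apply: limr_le; first exact: cvgP h.
apply: nearW => n; rewrite exprMn.
have := lip_sqr (n.+1%:R^-1 *: v + x) x; rewrite addrK sqZ exprVn.
move=> /(ler_wpM2l (sqr_ge0 n.+1%:R)) /le_trans; apply.
by rewrite [leLHS]mulrCA mulVKf// expf_neq0.
Qed.

End lipschitz_function.
End lipschitz.

(** * A Poincare inequality *)

Section poincare.
Context {R : realType}.

(** The derivative of [sin] at 0 in direction [a], read along [1/(n+1)]. *)
Lemma cvg_scaled_sin (a : R) : n.+1%:R * sin (a / n.+1%:R) @[n --> \oo] --> a.
Proof.
have ds : derivable (@sin R) 0 a by exact/diff_derivable/derivable1_diffP/derivable_sin.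
have := cvg_derive_seq ds; rewrite deriveE; last exact/derivable1_diffP/derivable_sin.
have -> : 'd sin 0 a = a.
  have -> : a = a *: (1 : R) by rewrite [RHS]mulr1.
  rewrite linearZ/= -deriveE; last exact/derivable1_diffP/derivable_sin.
  by rewrite derive_val cos0.
rewrite sin0; apply: cvg_trans; apply: near_eq_cvg; apply: nearW => n /=.
by rewrite subr0 addr0 [_ *: _]mulrC.
Qed.

Lemma cvg_scaled_cosB1 (a : R) : n.+1%:R * (cos (a / n.+1%:R) - 1) @[n --> \oo] --> (0 : R).
Proof.
have ds : derivable (@cos R) 0 a by exact/diff_derivable/derivable1_diffP/derivable_cos.
have := cvg_derive_seq ds; rewrite deriveE; last exact/derivable1_diffP/derivable_cos.
have -> : 'd cos 0 a = 0.
  have -> : a = a *: (1 : R) by rewrite [RHS]mulr1.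
  rewrite linearZ/= -deriveE; last exact/derivable1_diffP/derivable_cos.
  by rewrite derive_val sin0 oppr0 scaler0.
rewrite cos0; apply: cvg_trans; apply: near_eq_cvg; apply: nearW => n /=.
by rewrite addr0 [_ *: _]mulrC.
Qed.

Lemma cvg_bounded_sqr (u : nat -> R) (l : R) : u n @[n --> \oo] --> l ->
  exists2 B, 0 <= B & forall n, u n ^+ 2 <= B.
Proof.
move=> ul; have cu : cvgn (fun n => u n ^+ 2).
  apply/cvg_ex; exists (l ^+ 2); under eq_fun do rewrite expr2.
  by rewrite expr2; exact: cvgM.
have [B [Br HB]] := cvg_seq_bounded cu.
exists (`|B| + 1); first by rewrite addr_ge0.
move=> n; apply: (le_trans (ler_norm _)); apply: HB => //.
by rewrite (le_lt_trans (ler_norm _))// ltrDl.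
Qed.

Variables (m k : nat) (V : 'M[R]_(m, k)).
Hypothesis VV : V^T *m V = 1%:M.

(* Rotation by the angle t in each of the k planes spanned by a column of V
   in R^m and the matching basis vector of R^k. *)
Definition rotation (t : R) : 'M[R]_(m + k) :=
  block_mx (1%:M + (cos t - 1) *: (V *m V^T)) (sin t *: V)
           (- sin t *: V^T) (cos t)%:M.

(** [V V^T] is a projection because the columns of [V] are orthonormal, so the four blocks multiply
    by the addition formulas for [cos] and [sin]. *)
Lemma rotationD s t : rotation (s + t) = rotation s *m rotation t.
Proof.
have GV : V *m V^T *m V = V by rewrite -mulmxA VV mulmx1.
have GG : V *m V^T *m (V *m V^T) = V *m V^T by rewrite mulmxA GV.
have VG : V^T *m (V *m V^T) = V^T by rewrite mulmxA VV mul1mx.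
rewrite /rotation mulmx_block cosD sinD; congr block_mx.
- rewrite mulmxDl !mulmxDr !mul1mx mulmx1 -!scalemxAl -!scalemxAr GG !scalerA.
  rewrite -!addrA; congr (_ + _); rewrite -!scalerDl; congr (_ *: _); ring.
- rewrite mulmxDl mul1mx -!scalemxAl -!scalemxAr GV mul_mx_scalar !scalerA.
  by rewrite -!scalerDl; congr (_ *: _); ring.
- rewrite mulmxDr mulmx1 mul_scalar_mx -!scalemxAl -!scalemxAr VG !scalerA.
  by rewrite -!scalerDl; congr (_ *: _); ring.
- rewrite -!scalemxAl -!scalemxAr VV scalerA -scalar_mxM scalemx1 -raddfD/=.
  by congr (_%:M); ring.
Qed.

Lemma rotation0 : rotation 0 = 1%:M.
Proof. by rewrite /rotation cos0 sin0 subrr oppr0 !scale0r addr0 -scalar_mx_block. Qed.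

Lemma rotationT t : (rotation t)^T = rotation (- t).
Proof.
rewrite /rotation tr_block_mx cosN sinN opprK !linearZ/= linearD/= trmxK tr_scalar_mx.
by rewrite !linearZ/= trmx_mul trmxK !tr_scalar_mx.
Qed.

Lemma rotation_orthogonal t : (rotation t)^T *m rotation t = 1%:M.
Proof. by rewrite rotationT -rotationD addNr rotation0. Qed.

Lemma rotation_usubmx t (g : 'cV[R]_(m + k)) : usubmx (rotation t *m g) =
  usubmx g + ((cos t - 1) *: (V *m V^T *m usubmx g) + sin t *: (V *m dsubmx g)).
Proof.
rewrite -{1}[g]vsubmxK /rotation mul_block_col col_mxKu mulmxDl mul1mx.
by rewrite -!scalemxAl addrA.
Qed.

Variables (f : 'cV[R]_m -> R) (L : R).
Hypothesis df : forall x, differentiable f x.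
Hypothesis lipf : forall x y, `|f x - f y| <= L * enorm (x - y).

Lemma qgrowth_lip_diff p (A B : 'M[R]_(m, p)) :
  qgrowth (fun g : 'cV[R]_p => (f (A *m g) - f (B *m g)) ^+ 2).
Proof.
apply: (@qgrowth_le _ _ _ (fun g => L ^+ 2 * sq ((A - B) *m g))).
- apply: measurable_funX; apply: measurable_funB.
  + exact: (measurableT_comp (lip_measurable df) (measurable_mulmx_column A)).
  + exact: (measurableT_comp (lip_measurable df) (measurable_mulmx_column B)).
- by apply: qgrowthZ; apply: qgrowth_mulmx; exact: qgrowth_sq.
by move=> g; rewrite ger0_norm ?sqr_ge0// mulmxBl; exact: lip_sqr.
Qed.

Let F (g : 'cV[R]_(m + k)) := f (usubmx g).

(** The two block projections are written as matrices so that [qgrowth_mulmx] applies to them. *)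
Let top : 'M[R]_(m, m + k) := row_mx 1%:M 0.

Let topE (g : 'cV[R]_(m + k)) : top *m g = usubmx g.
Proof. by rewrite -{1}[g]vsubmxK mul_row_col mul1mx mul0mx addr0. Qed.

Let bottom : 'M[R]_(k, m + k) := row_mx 0 1%:M.

Let bottomE (g : 'cV[R]_(m + k)) : bottom *m g = dsubmx g.
Proof. by rewrite -{1}[g]vsubmxK mul_row_col mul1mx mul0mx add0r. Qed.

Let qF s t : qgrowth (fun g => (F (rotation s *m g) - F (rotation t *m g)) ^+ 2).
Proof.
have := qgrowth_lip_diff (top *m rotation s) (top *m rotation t).
by under eq_fun do rewrite -!mulmxA !topE.
Qed.

(** The increment telescopes into [n+1] steps of angle [a/(n+1)]. Cauchy-Schwarz costs a factor
    [n+1], and the steps all have the same mean square, which gives the second such factor. *)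
Lemma rotation_steps n (a : R) :
  \int[gaussian (m + k)]_g (F g - F (rotation a *m g)) ^+ 2 <=
  \int[gaussian (m + k)]_g (n.+1%:R * (F (rotation (a / n.+1%:R) *m g) - F g)) ^+ 2.
Proof.
set h := a / n.+1%:R; pose d j g := F (rotation (h *+ j) *m g) - F (rotation (h *+ j.+1) *m g).
have qd j : qgrowth (fun g => d j g ^+ 2) by exact: qF.
have E0 g : F g - F (rotation a *m g) = \sum_(j < n.+1) d j g.
  rewrite -(big_mkord xpredT (d ^~ g)) /d.
  rewrite (telescope_sumr_eq (fun j => - F (rotation (h *+ j) *m g)))//; last first.
    by move=> j _; rewrite opprK addrC.
  rewrite mulr0n rotation0 mul1mx opprK [RHS]addrC; congr (_ - F (rotation _ *m g)).
  by rewrite /h -mulr_natr divfK.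
have qsum : qgrowth (fun g => \sum_(j < n.+1) d j g ^+ 2) by apply: qgrowth_sum => j; exact: qd.
have qN : qgrowth (fun g => (F (rotation h *m g) - F g) ^+ 2).
  by have := qF h 0; under eq_fun do rewrite rotation0 mul1mx.
have qN0 : qgrowth (fun g => (F g - F (rotation a *m g)) ^+ 2).
  by have := qF 0 a; under eq_fun do rewrite rotation0 mul1mx.
apply: (@le_trans _ _ (\int[gaussian (m + k)]_g (n.+1%:R * \sum_(j < n.+1) d j g ^+ 2))).
  apply: Exp_le => //; first exact: qgrowthZ.
  by move=> g; rewrite E0; exact: (sqr_sum_le n.+1 (d ^~ g)).
rewrite ExpZ// Exp_sum//.
have -> : (fun g => (n.+1%:R * (F (rotation h *m g) - F g)) ^+ 2) =
    (fun g => n.+1%:R * (n.+1%:R * (F (rotation h *m g) - F g) ^+ 2)).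
  by apply/funext => g; ring.
rewrite ExpZ; last exact: qgrowthZ.
rewrite ExpZ// ler_wpM2l// mulr_natl -[in leRHS](card_ord n.+1) -sumr_const.
apply: ler_sum => j _.
(* Substituting the rotated point [rotation (h *+ j) *m g] for [g] turns the first step into step
   [j], up to sign. *)
rewrite -[leRHS](Rintegral_orthogonal (rotation_orthogonal (h *+ j)))//.
rewrite le_eqVlt; apply/orP; left; apply/eqP; congr (Rintegral _ _ _).
by apply/funext => g; rewrite /d mulmxA -rotationD -mulrS -sqrrN opprB.
Qed.

(** The right side of [rotation_steps] is a squared difference quotient of [f] at [x = usubmx g]
    along the velocity [v n g]. Since [c n] tends to 0 and [s n] to [a], the velocity tends to
    [a V z] with [z = dsubmx g]; bounds on [c n] and [s n] supply the majorant [H]. *)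
Lemma poincare_limit (a : R) :
  \int[gaussian (m + k)]_g (F g - F (rotation a *m g)) ^+ 2 <=
  \int[gaussian (m + k)]_g ('D_(a *: (V *m dsubmx g)) f (usubmx g)) ^+ 2 /\
  qgrowth (fun g : 'cV[R]_(m + k) => ('D_(a *: (V *m dsubmx g)) f (usubmx g)) ^+ 2).
Proof.
pose c n : R := n.+1%:R * (cos (a / n.+1%:R) - 1).
pose s n : R := n.+1%:R * sin (a / n.+1%:R).
pose Phi n g := (n.+1%:R * (F (rotation (a / n.+1%:R) *m g) - F g)) ^+ 2.
pose v n (g : 'cV[R]_(m + k)) := c n *: (V *m V^T *m usubmx g) + s n *: (V *m dsubmx g).
have PhiE n g : Phi n g =
    (n.+1%:R * (f (usubmx g + n.+1%:R^-1 *: v n g) - f (usubmx g))) ^+ 2.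
  rewrite /Phi /F rotation_usubmx /v /c /s scalerDr !scalerA !mulrA mulVf// !mul1r.
  by [].
have [C C0 cC] := cvg_bounded_sqr (@cvg_scaled_cosB1 a).
have [S S0 sS] := cvg_bounded_sqr (@cvg_scaled_sin a).
pose H (g : 'cV[R]_(m + k)) := L ^+ 2 * (2 * (C * sq (V *m V^T *m usubmx g) + S * sq (V *m dsubmx g))).
have mPhi n : measurable_fun setT (Phi n).
  have -> : Phi n = fun g => n.+1%:R ^+ 2 *
      (F (rotation (a / n.+1%:R) *m g) - F (rotation 0 *m g)) ^+ 2.
    by apply/funext => g; rewrite rotation0 mul1mx -exprMn.
  by have [] := qgrowthZ (n.+1%:R ^+ 2) (qF (a / n.+1%:R) 0).
have qH : qgrowth H.
  apply: qgrowthZ; apply: qgrowthZ; apply: qgrowthD; apply: qgrowthZ.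
    under eq_fun do rewrite -topE mulmxA.
    by apply: qgrowth_mulmx; exact: qgrowth_sq.
  under eq_fun do rewrite -bottomE mulmxA.
  by apply: qgrowth_mulmx; exact: qgrowth_sq.
have PhiH n g : `|Phi n g| <= H g.
  rewrite PhiE ger0_norm ?sqr_ge0// exprMn.
  have := lip_sqr lipf (usubmx g + n.+1%:R^-1 *: v n g) (usubmx g).
  rewrite [usubmx g + _ - _]addrAC subrr add0r sqZ exprVn => /(ler_wpM2l (sqr_ge0 n.+1%:R)) /le_trans; apply.
  rewrite [leLHS]mulrCA mulVKf ?expf_neq0// ler_wpM2l ?sqr_ge0//.
  rewrite (le_trans (sqD_le _ _))// ler_wpM2l// !sqZ.
  by apply: lerD; apply: ler_wpM2r; rewrite ?sq_ge0//; [exact: cC|exact: sS].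
have Phil g : Phi n g @[n --> \oo] --> ('D_(a *: (V *m dsubmx g)) f (usubmx g)) ^+ 2.
  under eq_fun do rewrite PhiE expr2; rewrite expr2.
  suff l : n.+1%:R * (f (usubmx g + n.+1%:R^-1 *: v n g) - f (usubmx g)) @[n --> \oo]
      --> 'D_(a *: (V *m dsubmx g)) f (usubmx g) by exact: cvgM.
  apply: (cvg_derive_lip df lipf).
  pose x1 := V *m V^T *m usubmx g; pose x2 := V *m dsubmx g.
  have le n : sq (v n g - a *: x2) <= 2 * (c n * c n * sq x1 + (s n - a) * (s n - a) * sq x2).
    by rewrite /v -/x1 -/x2 -addrA -scalerBl (le_trans (sqD_le _ _))// !sqZ !expr2.
  have cc := @cvg_scaled_cosB1 a; have ss := @cvg_scaled_sin a.
  apply: (@squeeze_cvgr _ _ _ _ (fun=> 0) (fun n =>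
     2 * (c n * c n * sq x1 + (s n - a) * (s n - a) * sq x2))).
  - by apply: nearW => n; rewrite sq_ge0/=.
  - exact: cvg_cst.
  - rewrite [X in _ --> X](_ : _ = 2 * (0 * 0 * sq x1 + (a - a) * (a - a) * sq x2));
      last by ring.
    apply: cvgM; first exact: cvg_cst.
    have sa : s n - a @[n --> \oo] --> a - a by apply: cvgB => //; exact: cvg_cst.
    apply: cvgD; apply: cvgM; [|exact: cvg_cst| |exact: cvg_cst].
      exact: (cvgM cc cc).
    exact: (cvgM sa sa).
split; last exact: (qgrowth_lim mPhi qH PhiH Phil).
have l := Exp_lim mPhi qH PhiH Phil.
rewrite -(cvg_lim _ l)//; apply: limr_ge; first exact: cvgP l.
by apply: nearW => n; exact: rotation_steps.
Qed.

Hypothesis cpartial : forall i, continuous (partial f i).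

Lemma partial_le i x : partial f i x ^+ 2 <= L ^+ 2.
Proof.
rewrite (le_trans (derive_lip df lipf _ _))// /sq (bigD1 i)//= big1 => [|j ji].
  by rewrite mxE !eqxx expr1n addr0 mulr1.
by rewrite mxE (negbTE ji) expr0n.
Qed.

Lemma qgrowth_partialM i j : qgrowth (fun x => partial f i x * partial f j x).
Proof.
apply: (@qgrowth_le _ _ _ (fun=> L ^+ 2)).
- by apply: measurable_funM; exact: continuous_measurable_column.
- exact: qgrowth_cst.
move=> x; have := partial_le i x; have := partial_le j x; rewrite ler_norml.
set a := partial f i x; set b := partial f j x => bL aL.
by have := sqr_ge0 (a + b); have := sqr_ge0 (a - b); nra.
Qed.

Lemma sum_partialE x : \sum_j (\sum_i V i j * partial f i x) ^+ 2 =
  \sum_j \sum_i \sum_l V i j * V l j * (partial f i x * partial f l x).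
Proof.
apply: eq_bigr => j _; rewrite expr2 mulr_suml.
by apply: eq_bigr => i _; rewrite mulr_sumr; apply: eq_bigr => l _; ring.
Qed.

Lemma qgrowth_sum_partial :
  qgrowth (fun x => \sum_j (\sum_i V i j * partial f i x) ^+ 2).
Proof.
under eq_fun do rewrite sum_partialE; do 3 apply: qgrowth_sum => ?.
by apply: qgrowthZ; exact: qgrowth_partialM.
Qed.

(** Both sides are the mean square norm of [V^T grad f]; linearity moves the expectation into the
    entries of [Cmat f]. *)
Lemma trace_Cmat : \tr (V^T *m Cmat f *m V) =
  \int[gaussian m]_x \sum_j (\sum_i V i j * partial f i x) ^+ 2.
Proof.
under eq_Rintegral do rewrite sum_partialE.
have q i j l : qgrowth (fun x => V i j * V l j * (partial f i x * partial f l x)).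
  by apply: qgrowthZ; exact: qgrowth_partialM.
rewrite Exp_sum; last by move=> j; do 2 apply: qgrowth_sum => ?.
apply: eq_bigr => j _; rewrite Exp_sum; last by move=> i; apply: qgrowth_sum.
rewrite mxE; under eq_bigr do rewrite mxE mulr_suml.
rewrite exchange_big/=; apply: eq_bigr => i _; rewrite Exp_sum//.
apply: eq_bigr => l _; rewrite ExpZ; last exact: qgrowth_partialM.
by rewrite !mxE greal_qgrowth; [ring|exact: qgrowth_partialM].
Qed.

Lemma poincare :
  \int[gaussian (m + k)]_g (f (usubmx g) - f (row_mx (1%:M - V *m V^T) V *m g)) ^+ 2 <=
  4 * \tr (V^T *m Cmat f *m V).
Proof.
(* At a quarter turn [cos] vanishes, so the component of [x] in the span of [V] is replaced by
   [V z]. *)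
have E (g : 'cV[R]_(m + k)) : usubmx (rotation (pi / 2) *m g) = row_mx (1%:M - V *m V^T) V *m g.
  rewrite rotation_usubmx cos_pihalf sin_pihalf sub0r scaleN1r scale1r.
  by rewrite -{4}[g]vsubmxK mul_row_col mulmxBl mul1mx addrA.
have [+ qd] := poincare_limit (pi / 2).
under eq_Rintegral do rewrite /F E.
move=> /le_trans; apply.
(* [w x] is the row of [V^T grad f(x)]. The directional derivative is [pi/2] times [w x *m z], and
   [Exp_sq_mulmx] averages its square over [z] with [x] fixed. *)
pose w x : 'M[R]_(1, k) := \row_j \sum_i V i j * partial f i x.
have dE x z : ('D_((pi / 2) *: (V *m dsubmx (col_mx x z))) f (usubmx (col_mx x z))) ^+ 2 =
    (pi / 2) ^+ 2 * sq (w x *m z).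
  rewrite col_mxKu col_mxKd differentiable_derive_sum// /sq big_ord1 -exprMn.
  congr (_ ^+ 2); rewrite mxE mulr_sumr.
  under eq_bigr do rewrite !mxE mulr_sumr mulr_suml.
  rewrite exchange_big/=; apply: eq_bigr => j _; rewrite mxE mulr_suml mulr_sumr.
  by apply: eq_bigr => i _; ring.
have pi4 : (pi / 2) ^+ 2 <= 4 :> R.
  by have := @pihalf_lt2 R; have := @pihalf_ge1 R; nra.
rewrite Rintegral_split// trace_Cmat -ExpZ; last first.
  exact: qgrowth_sum_partial.
apply: Exp_le.
- exact: (qgrowth_expectation qd).
- by apply: qgrowthZ; exact: qgrowth_sum_partial.
move=> x; under eq_Rintegral do rewrite dE.
rewrite ExpZ; last by apply: qgrowth_mulmx; exact: qgrowth_sq.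
have := Exp_sq_mulmx (w x); rewrite big_ord1.
under eq_bigr do rewrite mxE.
have : 0 <= \int[gaussian k]_z sq (w x *m z) by apply: Exp_ge0 => z; exact: sq_ge0.
by have := sqr_ge0 (pi / 2 : R); nra.
Qed.

End poincare.

(** * Derivative of the residual *)

Section residual_derivative.
Context {R : realType}.
Variables (m k : nat) (f : 'cV[R]_m -> R) (L : R).
Hypothesis df : forall x, differentiable f x.
Hypothesis lipf : forall x y, `|f x - f y| <= L * enorm (x - y).

Implicit Types V : 'M[R]_(m, k).

(* [slice_mx V] sends (x, z) to the point (1 - V V^T) x + V z at which mu
   evaluates f, and [slice_dmx V E] is its derivative in V in direction E. *)
Definition slice_mx (V : 'M[R]_(m, k)) : 'M[R]_(m, m + k) :=
  row_mx (1%:M - V *m V^T) V.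

Definition slice_dmx (V E : 'M[R]_(m, k)) : 'M[R]_(m, m + k) :=
  row_mx (- (E *m V^T + V *m E^T)) E.

(** The expansion in [h] is exact because [V V^T] is quadratic in [V]; the remainder is the constant
    matrix [S] below. *)
Lemma slice_mxD (V E : 'M[R]_(m, k)) h : slice_mx (h *: E + V) =
  slice_mx V + h *: (slice_dmx V E + h *: row_mx (- (E *m E^T)) 0).
Proof.
rewrite /slice_mx /slice_dmx scale_row_mx !scaler0 add_row_mx addr0 scale_row_mx add_row_mx.
congr row_mx; last by rewrite addrC.
rewrite linearD/= linearZ/= mulmxDl !mulmxDr -!scalemxAl -!scalemxAr.
apply/matrixP => i j; rewrite !mxE; ring.
Qed.

Lemma qgrowth_lip p (A : 'M[R]_(m, p)) : qgrowth (fun g : 'cV[R]_p => f (A *m g)).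
Proof.
apply: qgrowth_mulmx; apply: qgrowth_sqr; first exact: (lip_measurable df).
exact: (qgrowth_lip_sqr df lipf).
Qed.

Lemma mu_Rintegral x V :
  mu f x V = \int[gaussian k]_z f (slice_mx V *m col_mx x z).
Proof.
rewrite /mu; under [in RHS]eq_Rintegral do rewrite mul_row_col.
apply: greal_qgrowth; under eq_fun do rewrite -mul_row_col.
by have := qgrowth_slice x (qgrowth_lip (slice_mx V)).
Qed.

Lemma qgrowth_mu V : qgrowth (mu f ^~ V).
Proof.
under eq_fun do rewrite mu_Rintegral.
exact: (qgrowth_expectation (qgrowth_lip (slice_mx V))).
Qed.

Let top : 'M[R]_(m, m + k) := row_mx 1%:M 0.

Let topE (g : 'cV[R]_(m + k)) : top *m g = usubmx g.
Proof. by rewrite -{1}[g]vsubmxK mul_row_col mul1mx mul0mx addr0. Qed.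

Lemma qgrowth_slice_diff V :
  qgrowth (fun g : 'cV[R]_(m + k) => (f (usubmx g) - f (slice_mx V *m g)) ^+ 2).
Proof.
have := qgrowth_lip_diff df lipf top (slice_mx V).
by under eq_fun do rewrite topE.
Qed.

(** The residual is the mean over [z] of [f(x) - f(p)] with [p] the sampled point of the slice, so
    Jensen applies with [x] fixed. *)
Lemma residual_sqr_le x V : (f x - mu f x V) ^+ 2 <=
  \int[gaussian k]_z (f (usubmx (col_mx x z)) - f (slice_mx V *m col_mx x z)) ^+ 2.
Proof.
have q := qgrowth_slice x (qgrowth_lip (slice_mx V)).
have -> : f x - mu f x V =
    \int[gaussian k]_z (f (usubmx (col_mx x z)) - f (slice_mx V *m col_mx x z)).
  rewrite mu_Rintegral -{1}(Exp_cst k (f x)) -ExpB//; last exact: qgrowth_cst.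
  by apply: eq_Rintegral => z _; rewrite col_mxKu.
apply: Exp_jensen; last exact: (qgrowth_slice x (qgrowth_slice_diff V)).
under eq_fun do rewrite col_mxKu.
by apply: measurable_funB; [exact: measurable_cst|case: q].
Qed.

Lemma qgrowth_residual V : qgrowth (fun x => (f x - mu f x V) ^+ 2).
Proof.
apply: (@qgrowth_le _ _ _ _ _ (qgrowth_expectation (qgrowth_slice_diff V))).
  apply: measurable_funX; apply: measurable_funB; first exact: (lip_measurable df).
  by case: (qgrowth_mu V).
by move=> x; rewrite ger0_norm ?sqr_ge0//; exact: residual_sqr_le.
Qed.

Lemma Rres_Rintegral V : Rres f V = 2^-1 * \int[gaussian m]_x (f x - mu f x V) ^+ 2.
Proof. by rewrite /Rres greal_qgrowth//; exact: qgrowth_residual. Qed.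

Lemma residual_le V : \int[gaussian m]_x (f x - mu f x V) ^+ 2 <=
  \int[gaussian (m + k)]_g (f (usubmx g) - f (slice_mx V *m g)) ^+ 2.
Proof.
rewrite Rintegral_split; last exact: qgrowth_slice_diff.
apply: Exp_le; first exact: qgrowth_residual.
  exact: (qgrowth_expectation (qgrowth_slice_diff V)).
by move=> x; exact: residual_sqr_le.
Qed.

Variables (V E : 'M[R]_(m, k)).

Let S : 'M[R]_(m, m + k) := row_mx (- (E *m E^T)) 0.

(** A majorant, uniform in [n], of the squared difference quotients [quot n]; it uses that the step
    [1/(n+1)] is at most 1. *)
Let K (g : 'cV[R]_(m + k)) := L ^+ 2 * (2 * (sq (slice_dmx V E *m g) + sq (S *m g))).

Let qK : qgrowth K.
Proof.
by do 2 apply: qgrowthZ; apply: qgrowthD; apply: qgrowth_mulmx; exact: qgrowth_sq.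
Qed.

Let K0 g : 0 <= K g.
Proof. by rewrite mulr_ge0 ?sqr_ge0// mulr_ge0// addr_ge0// sq_ge0. Qed.

Let quot n g : R :=
  n.+1%:R * (f (slice_mx (n.+1%:R^-1 *: E + V) *m g) - f (slice_mx V *m g)).

Let quotE n g : quot n g = n.+1%:R * (f (slice_mx V *m g +
  n.+1%:R^-1 *: (slice_dmx V E *m g + n.+1%:R^-1 *: (S *m g))) - f (slice_mx V *m g)).
Proof. by rewrite /quot slice_mxD mulmxDl -scalemxAl mulmxDl -scalemxAl. Qed.

Let quot_sqr n g : quot n g ^+ 2 <= K g.
Proof.
rewrite quotE exprMn; set v := slice_dmx V E *m g + _.
have := lip_sqr lipf (slice_mx V *m g + n.+1%:R^-1 *: v) (slice_mx V *m g).
rewrite [slice_mx V *m g + _ - _]addrAC subrr add0r sqZ exprVn.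
move=> /(ler_wpM2l (sqr_ge0 n.+1%:R)) /le_trans; apply.
rewrite [leLHS]mulrCA mulVKf ?expf_neq0// ler_wpM2l ?sqr_ge0//.
rewrite (le_trans (sqD_le _ _))// ler_wpM2l// lerD2l sqZ ler_piMl ?sq_ge0//.
by rewrite exprVn invf_le1 ?exprn_gt0// exprn_ege1// ler1n.
Qed.

Let quot_cvg g : quot n g @[n --> \oo] --> 'D_(slice_dmx V E *m g) f (slice_mx V *m g).
Proof.
under eq_fun do rewrite quotE.
apply: (cvg_derive_lip df lipf).
under eq_fun do rewrite addrC addKr sqZ.
have h := @cvg_harmonic R.
rewrite -(mul0r (sq (S *m g))); apply: cvgM; last exact: cvg_cst.
rewrite -(mul0r 0); under eq_fun do rewrite expr2.
by apply: cvgM.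
Qed.

Let mquot n : measurable_fun setT (quot n).
Proof.
apply: measurable_funM => //; apply: measurable_funB.
  by case: (qgrowth_lip (slice_mx (n.+1%:R^-1 *: E + V))).
by case: (qgrowth_lip (slice_mx V)).
Qed.

Let quot_le n g : `|quot n g| <= 1 + K g.
Proof.
have := quot_sqr n g; rewrite ler_norml.
by have := sqr_ge0 (quot n g - 1); have := sqr_ge0 (quot n g + 1); nra.
Qed.

Let qK1 : qgrowth (fun g => 1 + K g).
Proof. by apply: qgrowthD => //; exact: qgrowth_cst. Qed.

Let qquot n : qgrowth (quot n).
Proof. exact: (qgrowth_le (mquot n) qK1 (quot_le n)). Qed.

Lemma qgrowth_derive_slice :
  qgrowth (fun g => 'D_(slice_dmx V E *m g) f (slice_mx V *m g)).
Proof. exact: (qgrowth_lim mquot qK1 quot_le quot_cvg). Qed.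

(** Existence of the derivative is assumed, so it may be identified along the steps [1/(n+1)].
    Dominated convergence is applied first over [z], for the quotients of [mu], and then over [x],
    for those of the squared residual. *)
Lemma derive_Rres : derivable (Rres f) V E ->
  'D_E (Rres f) V = - (\int[gaussian m]_x ((f x - mu f x V) *
     \int[gaussian k]_z 'D_(slice_dmx V E *m col_mx x z) f (slice_mx V *m col_mx x z))) /\
  qgrowth (fun x => (f x - mu f x V) *
     \int[gaussian k]_z 'D_(slice_dmx V E *m col_mx x z) f (slice_mx V *m col_mx x z)).
Proof.
move=> dR; pose d n x := \int[gaussian k]_z quot n (col_mx x z).
pose h n : R := n.+1%:R^-1.
have dE n x : d n x = n.+1%:R * (mu f x (h n *: E + V) - mu f x V).
  rewrite !mu_Rintegral -ExpB; last 2 first.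
  - exact: (qgrowth_slice x (qgrowth_lip (slice_mx (h n *: E + V)))).
  - exact: (qgrowth_slice x (qgrowth_lip (slice_mx V))).
  rewrite -ExpZ//; apply: qgrowthB.
  - exact: (qgrowth_slice x (qgrowth_lip (slice_mx (h n *: E + V)))).
  - exact: (qgrowth_slice x (qgrowth_lip (slice_mx V))).
pose r x := f x - mu f x V.
pose dl x := \int[gaussian k]_z 'D_(slice_dmx V E *m col_mx x z) f (slice_mx V *m col_mx x z).
pose Kx x := \int[gaussian k]_z K (col_mx x z).
have qKx : qgrowth Kx by exact: qgrowth_expectation.
have md n : measurable_fun setT (d n) by case: (qgrowth_expectation (qquot n)).
have mr : measurable_fun setT r.
  by apply: measurable_funB; [exact: (lip_measurable df)|case: (qgrowth_mu V)].
have d2 n x : d n x ^+ 2 <= Kx x.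
  have q2 : qgrowth (fun z : 'cV[R]_k => quot n (col_mx x z) ^+ 2).
    apply: (@qgrowth_le _ _ _ (fun z => K (col_mx x z))).
    - by apply: measurable_funX; exact: measurable_slice.
    - exact: qgrowth_slice.
    - by move=> z; rewrite ger0_norm ?sqr_ge0.
  apply: (@le_trans _ _ (\int[gaussian k]_z (quot n (col_mx x z) ^+ 2))).
    by apply: Exp_jensen => //; exact: measurable_slice.
  by apply: Exp_le => //; exact: qgrowth_slice.
have dlim x : d n x @[n --> \oo] --> dl x.
  apply: (@Exp_lim _ _ _ _ (fun z => 1 + K (col_mx x z))).
  - by move=> n; exact: measurable_slice.
  - exact: (qgrowth_slice x qK1).
  - by move=> n z; exact: quot_le.
  - by move=> z; exact: quot_cvg.
(* Moving [V] by [h E] changes the residual from [r] to [r - h d], and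
   [(r - h d)^2 - r^2 = -(2 r - h d) h d]; halve it and divide by [h]. *)
pose G n x := 2^-1 * (- (2 * r x - h n * d n x) * d n x).
have h01 n : 0 <= h n <= 1 by rewrite invr_ge0 ler0n invf_le1 ?ler1n.
have GE n : n.+1%:R * (Rres f (h n *: E + V) - Rres f V) = \int[gaussian m]_x G n x.
  rewrite !Rres_Rintegral -mulrBr -ExpB; [|exact: qgrowth_residual..].
  have qB := qgrowthB (qgrowth_residual (h n *: E + V)) (qgrowth_residual V).
  rewrite mulrCA -ExpZ// -ExpZ; last exact: qgrowthZ.
  apply: eq_Rintegral => x _; rewrite /G dE /r /h; field.
  by rewrite nat1r pnatr_eq0.
(* [G] equals [-r d + h d^2/2], where [h <= 1], [d^2 <= Kx] and [|r d| <= (r^2 + d^2)/2]. *)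
have GH n x : `|G n x| <= r x ^+ 2 + 2 * Kx x.
  have := d2 n x; have /andP[] := h01 n; rewrite /G ler_norml.
  have := sqr_ge0 (r x - d n x); have := sqr_ge0 (r x + d n x).
  have := sqr_ge0 (r x); have := sqr_ge0 (d n x).
  set a := r x; set b := d n x; set c := h n => *.
  have : c * b ^+ 2 <= b ^+ 2 by rewrite ler_piMl.
  have : 0 <= c * b ^+ 2 by rewrite mulr_ge0.
  by move=> *; apply/andP; split; nra.
have qH : qgrowth (fun x => r x ^+ 2 + 2 * Kx x).
  by apply: qgrowthD; [exact: qgrowth_residual|exact: qgrowthZ].
have mG n : measurable_fun setT (G n).
  do 2 apply: measurable_funM => //; apply: measurableT_comp => //.
  by apply: measurable_funB; apply: measurable_funM.
have Gl x : G n x @[n --> \oo] --> - (r x * dl x).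
  rewrite [X in _ --> X](_ : _ = 2^-1 * (- (2 * r x - 0 * dl x) * dl x)); last by field.
  apply: cvgM; first exact: cvg_cst.
  apply: cvgM; last exact: dlim.
  apply: cvgN; apply: cvgB; first exact: cvg_cst.
  by apply: cvgM; [exact: cvg_harmonic|exact: dlim].
have qrd : qgrowth (fun x => r x * dl x).
  have := qgrowthZ (-1) (qgrowth_lim mG qH GH Gl).
  by under eq_fun do rewrite mulN1r opprK.
split => //.
have l1 := cvg_derive_seq dR.
have l2 := Exp_lim mG qH GH Gl.
rewrite -(cvg_lim _ l1)//; under eq_fun do rewrite GE.
rewrite (cvg_lim _ l2)// -mulN1r -ExpZ//.
by apply: eq_Rintegral => x _; rewrite mulN1r.
Qed.

End residual_derivative.

(** * Bound on the gradient *)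

Section gradient_bound.
Context {R : realType}.
Variables (m k : nat) (f : 'cV[R]_m -> R) (L : R).
Hypothesis df : forall x, differentiable f x.
Hypothesis lipf : forall x y, `|f x - f y| <= L * enorm (x - y).
Implicit Types V B : 'M[R]_(m, k).

(** The derivative of [mu f x] at [V] in direction [B], negated in that of the residual, with the
    differentiation carried out under the integral. *)
Definition slice_derivative V B (x : 'cV[R]_m) : R :=
  \int[gaussian k]_z 'D_(slice_dmx V B *m col_mx x z) f (slice_mx V *m col_mx x z).

Lemma slice_derivative_sum V B x :
  slice_derivative V B x =
  \sum_i \sum_j B i j * slice_derivative V (delta_mx i j) x.
Proof.
have q E := qgrowth_slice x (qgrowth_derive_slice df lipf V E).
under [RHS]eq_bigr do under eq_bigr do rewrite -ExpZ//.
have qZ i j := qgrowthZ (B i j) (q (delta_mx i j)).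
under [RHS]eq_bigr do rewrite -Exp_sum//.
rewrite -Exp_sum; last by move=> i; apply: qgrowth_sum => j; exact: qZ.
apply: eq_Rintegral => z _; set g := col_mx x z.
(* [slice_dmx V] is linear in its direction, and so is the derivative of the differentiable [f]. *)
have -> : slice_dmx V B = \sum_i \sum_j B i j *: slice_dmx V (delta_mx i j).
  have sD : {morph slice_dmx V : X Y / X + Y}.
    move=> X Y; rewrite /slice_dmx add_row_mx -opprD; congr (row_mx (- _) _).
    by rewrite linearD/= mulmxDl mulmxDr addrACA.
  have s0 : slice_dmx V 0 = 0.
    by rewrite /slice_dmx trmx0 mul0mx mulmx0 addr0 oppr0 row_mx0.
  have sZ a X : slice_dmx V (a *: X) = a *: slice_dmx V X.
    by rewrite /slice_dmx scale_row_mx linearZ/= -scalemxAl -scalemxAr -scalerDr scalerN.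
  rewrite {1}[B]matrix_sum_delta (big_morph _ sD s0); apply: eq_bigr => i _.
  by rewrite (big_morph _ sD s0); apply: eq_bigr => j _; exact: sZ.
rewrite differentiable_derive_sum// mulmx_suml.
under [RHS]eq_bigr do under eq_bigr do rewrite differentiable_derive_sum// mulr_sumr.
under [LHS]eq_bigr do rewrite summxE mulr_suml.
rewrite exchange_big/=; apply: eq_bigr => i _; rewrite exchange_big/=.
apply: eq_bigr => l _; rewrite mulmx_suml summxE mulr_suml.
by apply: eq_bigr => j _; rewrite -scalemxAl mxE mulrA.
Qed.

(** Only the entrywise derivatives of [Rres f] are known to exist. They are recombined through the
    linearity of [slice_derivative], which avoids any total differentiability of [Rres f]. *)
Lemma sum_dRdV V B : (forall i j, derivable (Rres f) V (delta_mx i j)) ->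
  \sum_i \sum_j B i j * dRdV f V i j =
    - (\int[gaussian m]_x ((f x - mu f x V) * slice_derivative V B x)) /\
  qgrowth (fun x => (f x - mu f x V) * slice_derivative V B x).
Proof.
move=> dR.
have D i j := derive_Rres df lipf (dR i j).
have E x : (f x - mu f x V) * slice_derivative V B x = \sum_i \sum_j
    B i j * ((f x - mu f x V) * slice_derivative V (delta_mx i j) x).
  rewrite slice_derivative_sum mulr_sumr; apply: eq_bigr => i _.
  by rewrite mulr_sumr; apply: eq_bigr => j _; rewrite mulrCA.
have q i j := qgrowthZ (B i j) (D i j).2.
split; last first.
  by under eq_fun do rewrite E; apply: qgrowth_sum => i; apply: qgrowth_sum => j; exact: q.
under eq_Rintegral do rewrite E.
rewrite Exp_sum; last by move=> i; apply: qgrowth_sum => j; exact: q.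
rewrite -sumrN; apply: eq_bigr => i _; rewrite Exp_sum; last by move=> j; exact: q.
rewrite -sumrN; apply: eq_bigr => j _; rewrite ExpZ; last exact: (D i j).2.
by rewrite mxE (D i j).1 mulrN.
Qed.

Lemma sum_dRdV_le V B : (forall i j, derivable (Rres f) V (delta_mx i j)) ->
  \sum_i \sum_j B i j * dRdV f V i j <=
    3 / 2 * L ^+ 2 * \int[gaussian m]_x (f x - mu f x V) ^+ 2 +
    6^-1 * \sum_i \sum_j slice_dmx V B i j ^+ 2.
Proof.
move=> dR; have [-> q] := sum_dRdV B dR.
pose Q := slice_dmx V B.
have qQ : qgrowth (fun g : 'cV[R]_(m + k) => sq (Q *m g)).
  by apply: qgrowth_mulmx; exact: qgrowth_sq.
have qQ6 := qgrowthZ 6^-1 (qgrowth_expectation qQ).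
have qr := qgrowthZ (3 / 2 * L ^+ 2) (qgrowth_residual df lipf V).
apply: (@le_trans _ _ (\int[gaussian m]_x (3 / 2 * L ^+ 2 * (f x - mu f x V) ^+ 2 +
    6^-1 * \int[gaussian k]_z sq (Q *m col_mx x z)))).
  rewrite -mulN1r -ExpZ//; apply: Exp_le; first exact: qgrowthZ.
    exact: qgrowthD.
  move=> x; rewrite mulN1r -mulNr; set r := f x - _.
  have qD := qgrowth_slice x (qgrowth_derive_slice df lipf V B).
  have qx := qgrowth_slice x qQ.
  rewrite /slice_derivative -ExpZ// -[X in _ <= X + _](Exp_cst k).
  rewrite -ExpZ// -ExpD; [|exact: qgrowth_cst|exact: qgrowthZ].
  apply: Exp_le; first exact: qgrowthZ.
    by apply: qgrowthD; [exact: qgrowth_cst|exact: qgrowthZ].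
  (* AM-GM: [|r d| <= L |r| sqrt s], with the weights that are optimal once
     [sum_sqr_slice_dmx] bounds the mean of s. *)
  move=> z; have := derive_lip df lipf (slice_mx V *m col_mx x z) (Q *m col_mx x z).
  have := sq_ge0 (Q *m col_mx x z).
  set d := 'D_ _ _ _; set s := sq _ => s0 ds.
  have X0 : 0 <= 3 / 2 * L ^+ 2 * r ^+ 2 + 6^-1 * s.
    by have := mulr_ge0 (sqr_ge0 L) (sqr_ge0 r); lra.
  (* [(u + v)^2 >= 4 u v], and [4 (3/2)(1/6) = 1], so the right side is at least [L^2 r^2 s]. *)
  have rd : (- r * d) ^+ 2 <= (3 / 2 * L ^+ 2 * r ^+ 2 + 6^-1 * s) ^+ 2.
    have := ler_wpM2l (sqr_ge0 r) ds.
    have := sqr_ge0 (3 / 2 * L ^+ 2 * r ^+ 2 - 6^-1 * s).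
    by nra.
  by rewrite (le_trans (ler_norm _))// -(ler_pXn2r (n := 2))// ?nnegrE// real_normK ?num_real.
rewrite ExpD// ExpZ; last exact: qgrowth_residual.
rewrite lerD2l ExpZ; last exact: (qgrowth_expectation qQ).
by rewrite ler_wpM2l ?invr_ge0// -(Rintegral_split qQ); exact: Exp_sq_mulmx.
Qed.

End gradient_bound.

(** * Frobenius products as traces *)

Section frobenius.
Context {R : realType}.

Lemma sum_sqr_trace p q (A : 'M[R]_(p, q)) :
  \sum_i \sum_j A i j ^+ 2 = \tr (A *m A^T).
Proof.
apply: eq_bigr => i _; rewrite mxE; apply: eq_bigr => j _.
by rewrite mxE expr2.
Qed.

Lemma sum_mul_trace p q (A B : 'M[R]_(p, q)) :
  \sum_i \sum_j A i j * B i j = \tr (A *m B^T).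
Proof.
by apply: eq_bigr => i _; rewrite mxE; apply: eq_bigr => j _; rewrite mxE.
Qed.

(** The blocks [B V^T], [V B^T] and [B] each have the squared norm of [B]; the cross terms contain
    [V^T B] or its transpose and vanish. *)
Lemma sum_sqr_slice_dmx m k (V B : 'M[R]_(m, k)) :
  V^T *m V = 1%:M -> V^T *m B = 0 ->
  \sum_i \sum_j slice_dmx V B i j ^+ 2 = 3 * \sum_i \sum_j B i j ^+ 2.
Proof.
move=> VV VB; have BV : B^T *m V = 0 by rewrite -[LHS]trmxK trmx_mul trmxK VB trmx0.
rewrite !sum_sqr_trace /slice_dmx tr_row_mx mul_row_col mxtraceD.
rewrite linearN/= mulNmx mulmxN opprK linearD/= !trmx_mul !trmxK.
rewrite mulmxDl !mulmxDr !mulmxA -(mulmxA B) VV mulmx1 -(mulmxA B V^T) VB mulmx0 mul0mx.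
rewrite -(mulmxA V B^T V) BV mulmx0 mul0mx !mxtraceD mxtrace0 add0r addr0.
rewrite [\tr (V *m _ *m _ *m _)]mxtrace_mulC !mulmxA VV mul1mx mxtrace_mulC.
ring.
Qed.

End frobenius.

(** * The bound at the span of the trailing eigenvectors *)

Unset Implicit Arguments.

Theorem theorem3 (R : realType) (n k : nat) (f : 'cV[R]_(n + k) -> R)
  (L : R) (W : 'M[R]_(n + k)) (lam : nat -> R) :
  (0 < n)%N -> (0 < k)%N ->
  (* regularity and square integrability *)
  continuous f ->
  (forall x, differentiable f x) ->
  (forall i, continuous (partial f i)) ->
  (gint (fun x => ((f x) ^+ 2)%:E) < +oo)%E ->
  (forall i, gint (fun x => ((partial f i x) ^+ 2)%:E) < +oo)%E ->
  (* (i) Lipschitz with constant L *)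
  (forall x y, `|f x - f y| <= L * enorm (x - y)) ->
  (* eigendecomposition C = W Lambda W^T, W orthogonal, eigenvalues sorted *)
  W^T *m W = 1%:M ->
  Cmat f = W *m diag_mx (\row_(i < n + k) lam i) *m W^T ->
  (forall i, (i.+1 < n + k)%N -> lam i.+1 <= lam i) ->
  (* (ii) spectral gap lambda_n > lambda_{n+1} (lam is 0-indexed) *)
  lam n < lam n.-1 ->
  (* the partial derivatives of R exist at W2 *)
  (forall i j, derivable (Rres f) (rsubmx W) (delta_mx i j)) ->
  frob (grassgrad f (rsubmx W))
    <= L * (2 * Num.sqrt (n + k)%:R + Num.sqrt k%:R)
         * Num.sqrt (\sum_(n <= i < n + k) lam i).
Proof.
move=> n0 k0 _ df cpart _ _ lipf WW CE _ _ dR.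
set V := rsubmx W in dR *; set A := lsubmx W.
have WE : W = row_mx A V by rewrite hsubmxK.
have [VA VV] : V^T *m A = 0 /\ V^T *m V = 1%:M.
  move: WW; rewrite WE tr_row_mx mul_col_row scalar_mx_block.
  by move=> /eq_block_mx[_ _ -> ->].
have trE : \tr (V^T *m Cmat f *m V) = \sum_(n <= i < n + k) lam i.
  (* [V^T W] selects the last [k] coordinates, so [V^T C V] is the trailing diagonal block of
     eigenvalues. *)
  have VW : V^T *m W = row_mx 0 1%:M by rewrite WE mul_mx_row VA VV.
  rewrite CE !mulmxA VW -mulmxA.
  have -> : W^T *m V = (V^T *m W)^T by rewrite trmx_mul trmxK.
  have -> : \sum_(n <= i < n + k) lam i = \sum_(j < k) lam (j + n)%N.
    by rewrite -{1}[n]add0n big_addn addKn big_mkord.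
  rewrite VW -sum_mul_trace.
  apply: eq_bigr => j _; rewrite big_split_ord/= big1 ?add0r => [|i _]; last first.
    by rewrite row_mxEl [X in _ * X]mxE mulr0.
  have E (i : 'I_k) : (row_mx (0 : 'M[R]_(k, n)) 1%:M *m diag_mx (\row_(i < n + k) lam i)) j
      (rshift n i) * row_mx (0 : 'M[R]_(k, n)) 1%:M j (rshift n i) = (j == i)%:R * lam (i + n)%N.
    rewrite row_mxEr mul_mx_diag mxE row_mxEr !mxE /= addnC.
    by case: (j == i); rewrite ?mul0r// !mul1r mulr1.
  under eq_bigr do rewrite E.
  rewrite (bigD1 j)//= eqxx mul1r big1 ?addr0// => i ij.
  by rewrite eq_sym (negbTE ij) mul0r.
set lams := \sum_(n <= i < n + k) lam i in trE *.
have lams0 : 0 <= lams.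
  (* The sum of eigenvalues is a trace that equals a mean of squares. *)
  rewrite -trE (trace_Cmat V df lipf cpart); apply: Exp_ge0 => x.
  by apply: sumr_ge0 => j _; exact: sqr_ge0.
have L0 : 0 <= L by apply: (lip_ge0 lipf); rewrite addn_gt0 n0.
set D := dRdV f V; set B := grassgrad f V; set P := 1%:M - V *m V^T.
have VP : V^T *m P = 0 by rewrite mulmxBr mulmx1 mulmxA VV mul1mx subrr.
have PP : P *m P = P by rewrite {1}/P mulmxBl mul1mx -mulmxA VP mulmx0 subr0.
have PT : P^T = P by rewrite linearB/= trmx1 trmx_mul trmxK.
have VB : V^T *m B = 0 by rewrite /B /grassgrad mulmxA VP mul0mx.
set N := \sum_i \sum_j B i j ^+ 2.
(* [B = P D] with [P] a symmetric idempotent, so pairing [B] with [D] or with [B] itself gives the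
   same number. *)
have NE : N = \sum_i \sum_j B i j * D i j.
  rewrite /N sum_sqr_trace sum_mul_trace /B /grassgrad -/P -/D.
  by rewrite trmx_mul PT -mulmxA mxtrace_mulC -!mulmxA PP mulmxA mxtrace_mulC mulmxA.
have N0 : 0 <= N by apply: sumr_ge0 => i _; apply: sumr_ge0 => j _; exact: sqr_ge0.
have V0 := residual_le df lipf V.
have := poincare VV df lipf cpart; rewrite trE => /(le_trans V0) {}V0.
have := sum_dRdV_le df lipf B dR; rewrite -NE sum_sqr_slice_dmx// -/N => Nle.
(* The last term of [Nle] is [3 N/6 = N/2], absorbed on the left; the mean squared residual is at
   most [4 lams], and [2 (3/2) 4 = 12]. *)
have {}Nle : N <= 12 * L ^+ 2 * lams by have := ler_wpM2l (sqr_ge0 L) V0; lra.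
rewrite /frob -/N; set a := Num.sqrt (n + k)%:R; set b := Num.sqrt k%:R.
have a1 : 1 <= a by rewrite -sqrtr1 ler_wsqrtr// ler1n addn_gt0 n0.
have b1 : 1 <= b by rewrite -sqrtr1 ler_wsqrtr// ler1n.
have a2 : 2 <= a ^+ 2 by rewrite sqr_sqrtr// ler_nat; exact: leq_add n0 k0.
have rhs0 : 0 <= L * (2 * a + b) * Num.sqrt lams.
  by rewrite !mulr_ge0 ?sqrtr_ge0// addr_ge0 ?mulr_ge0 ?sqrtr_ge0.
rewrite -[leRHS](ger0_norm rhs0) -sqrtr_sqr ler_wsqrtr// (le_trans Nle)//.
(* [(2a + b)^2 = 4a^2 + 4ab + b^2 >= 8 + 4 + 1], which exceeds 12. *)
rewrite !exprMn sqr_sqrtr// ler_wpM2r// mulrC ler_wpM2l ?sqr_ge0//; nra.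
Qed.
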